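(* Let $A_1,B_1,L_1,A_2,L_2,\Gamma_1,\Gamma_2$ be real matrices of compatible dimensions such that $$A:=\begin{bmatrix}A_1 & L_1\Gamma_2\\ L_2\Gamma_1 & A_2\end{bmatrix}$$ is stable and $\operatorname{im}B_1\cap\operatorname{im}L_1=\{0\}$. Consider the preexisting system $$\Sigma:\quad \dot x_1=A_1x_1+L_1\Gamma_2x_2+B_1u_1,\quad \dot x_2=A_2x_2+L_2\Gamma_1x_1,$$ whose state $x_1$ is measured, with initial condition $x_1(0)=\delta_0$, $x_2(0)=0$. Let $P_1\in\mathbb R^{n_1\times\hat n_1}$ be a left invertible matrix and $P_1^\dagger\in\mathbb R^{\hat n_1\times n_1}$ a left inverse of it such that $$\operatorname{im}B_1\subseteq\operatorname{im}P_1,\qquad \operatorname{im}L_1\subseteq\ker P_1^\dagger,$$ and let $\overline P_1\in\mathbb R^{n_1\times(n_1-\hat n_1)}$ be a left invertible matrix with left inverse $\overline P_1^\dagger$ such that $P_1P_1^\dagger+\overline P_1\overline P_1^\dagger=I$. Let $\epsilon_1>0$ and let $\hat K_1$ be any feedback gain such that the dynamics $\dot{\hat\xi}_1=(P_1^\dagger A_1P_1+P_1^\dagger B_1\hat K_1)\hat\xi_1$ is internally stable and satisfies $$\|\hat\xi_1\|_{\mathcal L_2}\le\epsilon_1\quad\text{for all }\hat\xi_1(0)\in\hat{\mathcal B}.$$ Then the entire closed-loop system, with state $(x_1,x_2,\hat x_1)$, composed of $\Sigma$ and the controller $$\Pi_1':\quad \dot{\hat x}_1=P_1^\dagger A_1P_1\hat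 x_1+P_1^\dagger A_1\overline P_1\overline P_1^\dagger x_1,\qquad u_1=\hat K_1(P_1^\dagger x_1-\hat x_1),\qquad \hat x_1(0)=0,$$ is internally stable, and for each $i\in\{1,2\}$ $$\|x_i\|_{\mathcal L_2}\le\alpha_i'\epsilon_1+\beta_i(\overline P_1\overline P_1^\dagger\delta_0)\qquad\text{for all }\delta_0\in\mathcal B,$$ where $$\alpha_1':=\|(G_1'+I)P_1\|_{\mathcal H_\infty},\quad \alpha_2':=\|G_2'P_1\|_{\mathcal H_\infty},\quad G_i'(s):=E_i^{\sf T}(sI-A)^{-1}\bigl\{E_1\overline P_1\overline P_1^\dagger A_1+E_2L_2\Gamma_1\bigr\},$$ $$\beta_i(\zeta):=\|E_i^{\sf T}e^{At}E_1\zeta\|_{\mathcal L_2}\quad(\zeta\in\mathbb R^{n_1}),$$ and, for fixed $P_1$ and $P_1^\dagger$ (determined before the gain is designed), $\alpha_i'$ and $\beta_i$ are independent of the choice of $\hat K_1$.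
   Context: The state dimensions are $x_1(t)\in\mathbb R^{n_1}$, $x_2(t)\in\mathbb R^{n_2}$, $\hat x_1(t),\hat\xi_1(t)\in\mathbb R^{\hat n_1}$. $\mathcal B:=\{\delta\in\mathbb R^{n_1}:\|\delta\|\le1\}$ is the closed Euclidean unit ball and $\hat{\mathcal B}:=\{P_1^\dagger\delta:\delta\in\mathcal B\}\subset\mathbb R^{\hat n_1}$. A left inverse $P^\dagger$ of $P$ is any matrix with $P^\dagger P=I$ (not necessarily the Moore–Penrose inverse). $E_1:=\begin{bmatrix} I \\ 0 \end{bmatrix}$ and $E_2:=\begin{bmatrix} 0 \\ I \end{bmatrix}$ are the block embeddings of $\mathbb R^{n_1}$ and $\mathbb R^{n_2}$ into $\mathbb R^{n_1+n_2}$. A square matrix is stable if all its eigenvalues have negative real part; a linear time-invariant system is internally stable if its (closed-loop) state matrix is stable. $\|f\|_{\mathcal L_2}$ is the $\mathcal L_2$-norm on $[0,\infty)$ of a square-integrable vector-valued function and $\|G\|_{\mathcal H_\infty}$ is the $\mathcal H_\infty$-norm of a stable transfer matrix. *)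

(* Defs.v *)
From HB Require Import structures.
From mathcomp Require Import all_boot all_order all_algebra.
From mathcomp Require Import all_classical all_reals all_analysis.
From mathcomp Require Import complex.
Set Implicit Arguments.
Unset Strict Implicit.
Unset Printing Implicit Defensive.
Import Order.TTheory GRing.Theory Num.Theory.
Import numFieldNormedType.Exports.
Local Open Scope classical_set_scope.
Local Open Scope ring_scope.

Section Norms.
Context {R : realType}.

(* The library norm on matrices is the max norm, hence these definitions. *)
Definition enorm {n : nat} (v : 'cV[R]_n) : R :=
  Num.sqrt (\sum_(i < n) v i 0 ^+ 2).

Definition enormC {n : nat} (v : 'cV[R[i]]_n) : R :=
  Num.sqrt (\sum_(i < n) (complex.Re (v i 0) ^+ 2 + complex.Im (v i 0) ^+ 2)).

Definition unit_ball {n : nat} : set 'cV[R]_n := [set v | enorm v <= 1].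

Definition L2norm {n : nat} (f : R -> 'cV[R]_n) : \bar R :=
  sqrte (\int[lebesgue_measure]_(t in `[0%R, +oo[) ((enorm (f t) ^+ 2)%:E))%E.

(* Operator norm induced by the Euclidean norms, i.e. the largest singular
   value. *)
Definition spectral_norm {m n : nat} (M : 'M[R[i]]_(m, n)) : \bar R :=
  ereal_sup [set (enormC (M *m v))%:E | v in [set v | enormC v <= 1]].

(* Supremum over the imaginary axis of the spectral norm: the H_infinity norm
   of a stable proper rational transfer matrix. *)
Definition Hinf_norm {m n : nat} (G : R[i] -> 'M[R[i]]_(m, n)) : \bar R :=
  ereal_sup [set spectral_norm (G (Complex 0 w)) | w in [set: R]].

End Norms.

Section LinearSystems.
Context {R : realType}.

Definition mxC {m n : nat} (M : 'M[R]_(m, n)) : 'M[R[i]]_(m, n) :=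
  map_mx (real_complex R) M.

Definition stable_mx {n : nat} (M : 'M[R]_n) : Prop :=
  forall a : R[i], eigenvalue (mxC M) a -> complex.Re a < 0.

Definition expmx {n : nat} (M : 'M[R]_n) : 'M[R]_n :=
  limn (series (fun k : nat => k`!%:R^-1 *: M ^+ k)).

(* [x] solves x' = f on [0, +oo[; at the endpoint only continuity is asked, so
   values of [x] at negative times are irrelevant. *)
Definition solves {n : nat} (x f : R -> 'cV[R]_n) : Prop :=
  {within `[0, +oo[, continuous x} /\
  (forall t : R, 0 < t -> is_derive t (1 : R) x (f t)).

Definition E1 (n1 n2 : nat) : 'M[R]_(n1 + n2, n1) := col_mx 1%:M 0.
Definition E2 (n1 n2 : nat) : 'M[R]_(n1 + n2, n2) := col_mx 0 1%:M.

End LinearSystems.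

Section Interconnection.
Context {R : realType} {n1 n2 nh m p1 p2 : nat}.
Variables (A1 : 'M[R]_n1) (B1 : 'M[R]_(n1, m)) (L1 : 'M[R]_(n1, p1)).
Variables (A2 : 'M[R]_n2) (L2 : 'M[R]_(n2, p2)).
Variables (Gam1 : 'M[R]_(p2, n1)) (Gam2 : 'M[R]_(p1, n2)).
Variables (P1 : 'M[R]_(n1, nh)) (P1d : 'M[R]_(nh, n1)).
Variables (Pb : 'M[R]_(n1, n1 - nh)) (Pbd : 'M[R]_(n1 - nh, n1)).
Variable (K : 'M[R]_(m, nh)).

Definition sys_mx : 'M[R]_(n1 + n2) :=
  block_mx A1 (L1 *m Gam2) (L2 *m Gam1) A2.

Definition preexisting_system (d0 : 'cV[R]_n1)
    (u1 : R -> 'cV[R]_m) (x1 : R -> 'cV[R]_n1) (x2 : R -> 'cV[R]_n2) : Prop :=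
  [/\ solves x1 (fun t => A1 *m x1 t + L1 *m Gam2 *m x2 t + B1 *m u1 t),
      solves x2 (fun t => A2 *m x2 t + L2 *m Gam1 *m x1 t),
      x1 0 = d0 & x2 0 = 0].

Definition controller
    (x1 : R -> 'cV[R]_n1) (u1 : R -> 'cV[R]_m) (xh : R -> 'cV[R]_nh) : Prop :=
  [/\ solves xh (fun t => P1d *m A1 *m P1 *m xh t
                          + P1d *m A1 *m Pb *m Pbd *m x1 t),
      forall t : R, 0 <= t -> u1 t = K *m (P1d *m x1 t - xh t)
    & xh 0 = 0].

(* State matrix of the closed loop in the coordinates ((x1, x2), xh); the lemma
   below checks it against the equations above. *)
Definition closed_loop_mx : 'M[R]_(n1 + n2 + nh) :=
  block_mx
    (block_mx (A1 + B1 *m K *m P1d) (L1 *m Gam2) (L2 *m Gam1) A2)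
    (col_mx (- (B1 *m K)) 0)
    (row_mx (P1d *m A1 *m Pb *m Pbd) 0)
    (P1d *m A1 *m P1).

Lemma closed_loop_mxE (x1 : 'cV[R]_n1) (x2 : 'cV[R]_n2) (xh : 'cV[R]_nh) :
  closed_loop_mx *m col_mx (col_mx x1 x2) xh =
  col_mx
    (col_mx
      (A1 *m x1 + L1 *m Gam2 *m x2 + B1 *m (K *m (P1d *m x1 - xh)))
      (A2 *m x2 + L2 *m Gam1 *m x1))
    (P1d *m A1 *m P1 *m xh + P1d *m A1 *m Pb *m Pbd *m x1).
Proof.
rewrite /closed_loop_mx !(mul_block_col, mul_col_mx, mul_row_col) add_col_mx.
rewrite !mul0mx !addr0 mulmxDl !mulmxBr !mulNmx !mulmxA.
congr (col_mx (col_mx _ _) _).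
- by rewrite !addrA; congr (_ - _); rewrite addrAC.
- exact: addrC.
- exact: addrC.
Qed.

(* The transfer matrix E^T (sI - A)^{-1} {E1 Pb Pbd A1 + E2 L2 Gam1}, to be used
   with E = E1 and E = E2. *)
Definition transfer {k : nat} (E : 'M[R]_(n1 + n2, k)) (s : R[i]) :
    'M[R[i]]_(k, n1) :=
  mxC E^T *m invmx (s%:M - mxC sys_mx) *m
  mxC (E1 n1 n2 *m Pb *m Pbd *m A1 + E2 n1 n2 *m L2 *m Gam1).

Definition free_response_norm {k : nat} (E : 'M[R]_(n1 + n2, k))
    (z : 'cV[R]_n1) : \bar R :=
  L2norm (fun t : R => E^T *m expmx (t *: sys_mx) *m E1 n1 n2 *m z).

End Interconnection.

(* Main.v *)
(* With [xi = P1d x1 - xh] and [z1 = x1 - P1 xi] the closed loop becomes a cascade: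
   [xi] obeys the designed dynamics and drives [(z1, x2)], whose state matrix is the
   one of the preexisting system. This gives stability, and splits [x_i] into a free
   response, with norm [beta_i], and the response to [xi] through [(G_i + J) P1],
   where [J] is 1 or 0.

   The H_infinity bound on the second part is obtained without Plancherel. Every
   signal is an output [C w] of one stable system [w' = M w], so its squared L2 norm
   is [w(0)^T X w(0)] where [X] solves [M^T X + X M = - C^T C]. Comparing two outputs
   amounts to the sign of [v^T Z v] for a difference [Z] of such solutions. On the
   imaginary axis the real part of [v^T Z (s - M)^-1 v] is half the difference of the
   squared norms of the two Laplace transforms, hence nonnegative; the minimum
   principle for rational functions extends this to the right half-plane, and
   multiplying by [s] and letting [s] tend to infinity gives [v^T Z v >= 0]. *)
Require Import Defs.
From HB Require Import structures.
From mathcomp Require Import all_boot all_order all_algebra.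
From mathcomp Require Import all_classical all_reals all_analysis.
From mathcomp Require Import complex ring lra.
Import Order.TTheory GRing.Theory Num.Theory.
Import numFieldNormedType.Exports.
Set Implicit Arguments.
Unset Strict Implicit.
Unset Printing Implicit Defensive.
Local Open Scope classical_set_scope.
Local Open Scope ring_scope.

(** * Stable matrices and the Lyapunov equation *)

Section Stability.
Context {R : realType}.
Implicit Types n k : nat.

Lemma mxC_mul m n k (A : 'M[R]_(m, n)) (B : 'M[R]_(n, k)) :
  mxC (A *m B) = mxC A *m mxC B.
Proof. exact: matrix.map_mxM. Qed.

Lemma mxC1 n : mxC (1%:M : 'M[R]_n) = 1%:M.
Proof. exact: map_mx1. Qed.

Lemma eigenvalue_unitmx (F : fieldType) n (M : 'M[F]_n) (s : F) :
  (s%:M - M \in unitmx) = ~~ eigenvalue M s.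
Proof.
rewrite /eigenvalue /eigenspace negbK kermx_eq0 row_free_unit.
have -> : M - s%:M = -1 *: (s%:M - M) by rewrite scaleN1r opprB.
by rewrite unitmxZ// unitrN1.
Qed.

Lemma stable_mx_unit n (M : 'M[R]_n) (s : R[i]) :
  stable_mx M -> 0 <= complex.Re s -> s%:M - mxC M \in unitmx.
Proof.
move=> sM s0; rewrite eigenvalue_unitmx; apply/negP => /sM.
by rewrite ltNge s0.
Qed.

(* Cayley-Hamilton with the characteristic polynomial split over the algebraic
   closure. *)
Lemma eigenvalues_annihilate n (M : 'M[R]_n) : stable_mx M ->
  exists2 rs : seq R[i], {in rs, forall r, complex.Re r < 0} &
    foldr (fun r N => (mxC M - r%:M) *m N) 1%:M rs = 0.
Proof.
case: n M => [M _|n M sM]; first by exists [::] => //; exact: flatmx0.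
have [rs prs] := closed_field_poly_normal (char_poly (mxC M)).
rewrite (monicP (char_poly_monic _)) scale1r in prs.
exists rs => [r rrs|].
  apply: sM; rewrite eigenvalue_root_char prs.
  by rewrite root_prod_XsubC.
have := Cayley_Hamilton (mxC M); rewrite prs rmorph_prod/= => <-.
elim: rs {prs} => [|r rs ih]; first by rewrite big_nil.
by rewrite big_cons/= ih rmorphB/= horner_mx_X horner_mx_C.
Qed.

(** The equation gives [X M = - M^T X], hence [X p(M) = p(- M^T) X] for every polynomial [p]. When
    [p] has the roots [rs], the left side vanishes, while [p(- M^T)] is invertible: the roots lie in
    the left half-plane and the eigenvalues of [- M^T] in the right one. *)
Lemma sylvester_injective n (M X : 'M[R]_n) :
  stable_mx M -> M^T *m X + X *m M = 0 -> X = 0.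
Proof.
move=> sM MX.
have [rs rs_lt0 Mrs] := eigenvalues_annihilate sM.
have mX : mxC X *m mxC M = - (mxC M)^T *m mxC X.
  apply/eqP; rewrite mulNmx -subr_eq0 opprK addrC matrix.map_trmx -!mxC_mul -map_mxD.
  by rewrite MX map_mx0.
have swap : mxC X *m foldr (fun r N => (mxC M - r%:M) *m N) 1%:M rs =
    foldr (fun r N => (- (mxC M)^T - r%:M) *m N) 1%:M rs *m mxC X.
  elim: rs {rs_lt0 Mrs} => [|r rs ih] /=; first by rewrite mulmx1 mul1mx.
  rewrite mulmxA mulmxBr mX mul_mx_scalar -mul_scalar_mx -mulmxBl.
  by rewrite -[LHS]mulmxA ih mulmxA.
have rsU : foldr (fun r N => (- (mxC M)^T - r%:M) *m N) 1%:M rs \in unitmx.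
  elim: rs rs_lt0 {Mrs swap} => [|r rs ih] rs_lt0; first exact: unitmx1.
  rewrite /= unitmx_mul ih ?andbT; last first.
    by move=> x xrs; apply: rs_lt0; rewrite inE xrs orbT.
  have rr : 0 <= complex.Re (- r).
    by have := rs_lt0 _ (mem_head _ _); case: (r) => a b /= /ltW; rewrite oppr_ge0.
  have -> : - (mxC M)^T - r%:M = ((- r)%:M - mxC M)^T.
    by rewrite linearB/= tr_scalar_mx [in RHS]addrC -[- r]mulN1r -scale_scalar_mx scaleN1r.
  by rewrite unitmx_tr stable_mx_unit.
have /matrixP X0 : mxC X = 0 by rewrite -(mulKmx rsU (mxC X)) -swap Mrs !mulmx0.
by apply/matrixP => i j; have := X0 i j; rewrite !mxE => -[].
Qed.

(** An injective endomorphism of the finite-dimensional space of matrices is onto, which gives [X].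
    Symmetry follows from uniqueness, since [X^T] solves the same equation. *)
Lemma lyapunov_solution n (M Q : 'M[R]_n) : stable_mx M -> Q^T = Q ->
  exists2 X : 'M[R]_n, X^T = X & M^T *m X + X *m M = - Q.
Proof.
move=> sM QT.
pose f (X : 'M[R]_n) := M^T *m X + X *m M.
have lf : linear f.
  by move=> a X Y; rewrite /f mulmxDr mulmxDl -scalemxAr -scalemxAl scalerDr addrACA.
pose L : {linear 'M[R]_n -> 'M[R]_n} := HB.pack f (GRing.isLinear.Build _ _ _ _ f lf).
have LU : lin_mx L \in unitmx.
  rewrite -row_free_unit -kermx_eq0; apply/eqP/row_matrixP => i.
  rewrite row0; have : row i (kermx (lin_mx L)) *m lin_mx L = 0.
    by rewrite -row_mul mulmx_ker row0.
  rewrite -[X in X *m _]vec_mxK mul_vec_lin => /(congr1 vec_mx).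
  rewrite mxvecK linear0 => /(sylvester_injective sM) /(congr1 mxvec).
  by rewrite vec_mxK linear0.
pose X := vec_mx (mxvec (- Q) *m invmx (lin_mx L)).
have LX : M^T *m X + X *m M = - Q.
  by apply: (can_inj mxvecK); rewrite -(mul_vec_lin L) vec_mxK mulmxKV.
exists X => //; apply/eqP; rewrite -subr_eq0; apply/eqP/(sylvester_injective sM).
have := congr1 trmx LX; rewrite raddfD/= !trmx_mul trmxK raddfN/= QT => LXT.
by rewrite mulmxBr mulmxBl addrACA -opprD LX [X in X - _]addrC LXT subrr.
Qed.

(** Eigenvectors are row vectors here: the first block of one, if nonzero, is an eigenvector of [A];
    otherwise the second block is one of [D]. *)
Lemma stable_block_mx n k (A : 'M[R]_n) (B : 'M[R]_(n, k)) (D : 'M[R]_k) :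
  stable_mx A -> stable_mx D -> stable_mx (block_mx A B 0 D).
Proof.
move=> sA sD a /eigenvalueP[v]; rewrite -[v]hsubmxK.
set v1 := lsubmx v; set v2 := rsubmx v.
rewrite /mxC map_block_mx map_mx0 mul_row_block mulmx0 addr0 scale_row_mx.
move=> /eq_row_mx[e1 e2]; have [v10|v10 _] := eqVneq v1 0; last first.
  by apply: sA; apply/eigenvalueP; exists v1.
rewrite v10 => v20; apply: sD; apply/eigenvalueP; exists v2.
  by rewrite -e2 v10 mul0mx add0r.
by apply: contraNneq v20 => ->; rewrite row_mx0.
Qed.

Lemma stable_mx_similar n (M N S T : 'M[R]_n) :
  T *m S = 1%:M -> S *m M = N *m S -> stable_mx N -> stable_mx M.
Proof.
move=> TS SM sN a /eigenvalueP[v va v0]; apply: sN; apply/eigenvalueP.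
have ST := mulmx1C TS.
exists (v *m mxC T); last first.
  apply: contraNneq v0 => vT; rewrite -[v]mulmx1 -(matrix.map_mx1 (real_complex R)) -TS.
  by rewrite matrix.map_mxM mulmxA vT mul0mx.
have -> : mxC N = mxC S *m mxC M *m mxC T.
  by rewrite -!mxC_mul SM -mulmxA ST mulmx1.
rewrite !mulmxA -[v *m _ *m mxC S]mulmxA -mxC_mul TS mxC1 mulmx1.
by rewrite va scalemxAl.
Qed.

End Stability.

(** * Real and imaginary parts of complex numbers and matrices *)

Section ComplexParts.
Context {R : realType}.
Implicit Types z : R[i].

Lemma cReD z1 z2 : complex.Re (z1 + z2) = complex.Re z1 + complex.Re z2.
Proof. by case: z1 z2 => [a b] [c d]. Qed.

Lemma cImD z1 z2 : complex.Im (z1 + z2) = complex.Im z1 + complex.Im z2.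
Proof. by case: z1 z2 => [a b] [c d]. Qed.

Lemma cReN z : complex.Re (- z) = - complex.Re z.
Proof. by case: z. Qed.

Lemma cReM z1 z2 : complex.Re (z1 * z2) =
  complex.Re z1 * complex.Re z2 - complex.Im z1 * complex.Im z2.
Proof. by case: z1 z2 => [a b] [c d]. Qed.

Lemma cImM z1 z2 : complex.Im (z1 * z2) =
  complex.Re z1 * complex.Im z2 + complex.Im z1 * complex.Re z2.
Proof. by case: z1 z2 => [a b] [c d]. Qed.

Lemma cReV z : complex.Re z^-1 =
  complex.Re z / (complex.Re z ^+ 2 + complex.Im z ^+ 2).
Proof. by case: z. Qed.

Lemma cImV z : complex.Im z^-1 =
  - (complex.Im z / (complex.Re z ^+ 2 + complex.Im z ^+ 2)).
Proof. by case: z. Qed.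

Lemma cIm_real_complex (x : R) : complex.Im (real_complex R x) = 0.
Proof. by []. Qed.

Lemma sqr_Re_Im_eq0 z : (complex.Re z ^+ 2 + complex.Im z ^+ 2 == 0) = (z == 0).
Proof.
case: z => a b /=; rewrite eq_complex/= paddr_eq0 ?sqr_ge0//.
by rewrite !sqrf_eq0.
Qed.

Lemma cRe_sum I (r : seq I) (P : pred I) (F : I -> R[i]) :
  complex.Re (\sum_(i <- r | P i) F i) = \sum_(i <- r | P i) complex.Re (F i).
Proof. by apply: (big_morph _ cReD). Qed.

Lemma cIm_sum I (r : seq I) (P : pred I) (F : I -> R[i]) :
  complex.Im (\sum_(i <- r | P i) F i) = \sum_(i <- r | P i) complex.Im (F i).
Proof. by apply: (big_morph _ cImD). Qed.

End ComplexParts.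

Section ComplexMatrixParts.
Context {R : realType}.

Lemma map_Re_mulmxC m n k (A : 'M[R[i]]_(m, n)) (B : 'M[R]_(n, k)) :
  map_mx (@complex.Re R) (A *m mxC B) = map_mx (@complex.Re R) A *m B.
Proof.
apply/matrixP => i j; rewrite !mxE cRe_sum; apply: eq_bigr => l _.
by rewrite !mxE cReM mulr0 subr0.
Qed.

Lemma map_Im_mulmxC m n k (A : 'M[R[i]]_(m, n)) (B : 'M[R]_(n, k)) :
  map_mx (@complex.Im R) (A *m mxC B) = map_mx (@complex.Im R) A *m B.
Proof.
apply/matrixP => i j; rewrite !mxE cIm_sum; apply: eq_bigr => l _.
by rewrite !mxE cImM mulr0 add0r.
Qed.

Lemma map_Re_mxCmul m n k (A : 'M[R]_(m, n)) (B : 'M[R[i]]_(n, k)) :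
  map_mx (@complex.Re R) (mxC A *m B) = A *m map_mx (@complex.Re R) B.
Proof.
apply/matrixP => i j; rewrite !mxE cRe_sum; apply: eq_bigr => l _.
by rewrite !mxE cReM mul0r subr0.
Qed.

Lemma map_Im_mxCmul m n k (A : 'M[R]_(m, n)) (B : 'M[R[i]]_(n, k)) :
  map_mx (@complex.Im R) (mxC A *m B) = A *m map_mx (@complex.Im R) B.
Proof.
apply/matrixP => i j; rewrite !mxE cIm_sum; apply: eq_bigr => l _.
by rewrite !mxE cImM mul0r addr0.
Qed.

End ComplexMatrixParts.

(** * The minimum principle for rational functions on the right half-plane *)

Section MinimumPrinciple.
Context {R : realType}.

(** The minimum principle concerns real parts, so continuity is kept at the level of real-valued
    functions. *)
Definition ccontinuous {T : topologicalType} (f : T -> R[i]) (x : T) :=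
  continuous_at x (fun t => complex.Re (f t)) /\
  continuous_at x (fun t => complex.Im (f t)).

Lemma ccontinuous_cst {T : topologicalType} (c : R[i]) (x : T) : ccontinuous (fun=> c) x.
Proof. by split; exact: cvg_cst. Qed.

Lemma ccontinuousD {T : topologicalType} (f g : T -> R[i]) x :
  ccontinuous f x -> ccontinuous g x -> ccontinuous (fun t => f t + g t) x.
Proof.
move=> [f1 f2] [g1 g2]; split.
- rewrite (_ : (fun _ => _) = (fun t => complex.Re (f t) + complex.Re (g t))).
    by apply: cvgD.
  by apply/funext => t; rewrite cReD.
- rewrite (_ : (fun _ => _) = (fun t => complex.Im (f t) + complex.Im (g t))).
    by apply: cvgD.
  by apply/funext => t; rewrite cImD.
Qed.

Lemma ccontinuousM {T : topologicalType} (f g : T -> R[i]) x :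
  ccontinuous f x -> ccontinuous g x -> ccontinuous (fun t => f t * g t) x.
Proof.
move=> [f1 f2] [g1 g2]; split.
- rewrite (_ : (fun _ => _) = (fun t => complex.Re (f t) * complex.Re (g t)
      - complex.Im (f t) * complex.Im (g t))).
    by apply: cvgB; apply: cvgM.
  by apply/funext => t; rewrite cReM.
- rewrite (_ : (fun _ => _) = (fun t => complex.Re (f t) * complex.Im (g t)
      + complex.Im (f t) * complex.Re (g t))).
    by apply: cvgD; apply: cvgM.
  by apply/funext => t; rewrite cImM.
Qed.

Lemma ccontinuousV {T : topologicalType} (f : T -> R[i]) x :
  f x != 0 -> ccontinuous f x -> ccontinuous (fun t => (f t)^-1) x.
Proof.
move=> fx0 [f1 f2].
have c : continuous_at x (fun t => (complex.Re (f t) ^+ 2 + complex.Im (f t) ^+ 2)^-1).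
  apply: cvgV; first by rewrite sqr_Re_Im_eq0.
  by apply: cvgD; apply: cvgM.
split.
- rewrite (_ : (fun _ => _) = (fun t => complex.Re (f t) *
      (complex.Re (f t) ^+ 2 + complex.Im (f t) ^+ 2)^-1)).
    exact: cvgM.
  by apply/funext => t; rewrite cReV.
- rewrite (_ : (fun _ => _) = (fun t => - (complex.Im (f t) *
      (complex.Re (f t) ^+ 2 + complex.Im (f t) ^+ 2)^-1))).
    by apply: cvgN; apply: cvgM.
  by apply/funext => t; rewrite cImV.
Qed.

Lemma ccontinuous_horner {T : topologicalType} (p : {poly R[i]}) (f : T -> R[i]) x :
  ccontinuous f x -> ccontinuous (fun t => p.[f t]) x.
Proof.
move=> cf; elim/poly_ind: p => [|p c ih].
  rewrite (_ : (fun _ => _) = fun=> 0); first exact: ccontinuous_cst.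
  by apply/funext => t; rewrite horner0.
rewrite (_ : (fun _ => _) = fun t => p.[f t] * f t + c).
  by apply: ccontinuousD; [exact: ccontinuousM | exact: ccontinuous_cst].
by apply/funext => t; rewrite hornerMXaddC.
Qed.

(* A nonconstant rational function is open: with [k] the order of [s0] as a zero
   of [p/q - p(s0)/q(s0)], moving from [s0] in a direction whose k-th power is
   suitably chosen decreases the real part. *)
Lemma rational_Re_decrease (p q : {poly R[i]}) (s0 : R[i]) :
  q.[s0] != 0 -> p * q.[s0]%:P - q * p.[s0]%:P != 0 ->
  exists th : R[i], \forall r \near (0 : R)^'+,
    complex.Re (p.[s0 + real_complex R r * th] / q.[s0 + real_complex R r * th])
    < complex.Re (p.[s0] / q.[s0]).
Proof.
move=> q0 N0; set N := _ - _ in N0.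
have [k [N1 N1s0 NE]] := multiplicity_XsubC N s0.
rewrite N0/= in N1s0.
(* The polynomial [N] vanishes at [s0] by construction. *)
have k0 : (0 < k)%N.
  rewrite lt0n; apply/eqP => k0; move: N1s0; rewrite rootE.
  have := congr1 (horner^~ s0) NE; rewrite k0 expr0 mulr1 /= => <-.
  by rewrite !hornerE mulrC subrr eqxx.
(* The increment of [p/q] has leading coefficient [c] at [s0]; taking for [th] a k-th root of
   [- c^-1] turns the leading term [c (r th)^k] into [- r^k]. *)
pose c := N1.[s0] / (q.[s0] * q.[s0]).
pose th := k.-root (- c^-1)%C : R[i].
have thk : th ^+ k = - c^-1 by rewrite rootCK.
exists th.
pose sr (r : R) := s0 + real_complex R r * th.
have csr (r : R) : ccontinuous sr r.
  apply: ccontinuousD; first exact: ccontinuous_cst.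
  apply: ccontinuousM; last exact: ccontinuous_cst.
  by split; [exact: cvg_id | exact: cvg_cst].
(* The increment of [p/q] divided by [r^k]; it is continuous at [0] with value [-1] there. *)
pose h r := th ^+ k * (N1.[sr r] / (q.[sr r] * q.[s0])).
have sr0 : sr 0 = s0 by rewrite /sr rmorph0 mul0r addr0.
have c0 : c != 0 by rewrite mulf_neq0// invr_neq0// mulf_neq0.
have [ch _] : ccontinuous h 0.
  apply: ccontinuousM; first exact: ccontinuous_cst.
  apply: ccontinuousM; first exact: ccontinuous_horner.
  apply: ccontinuousV; first by rewrite sr0 mulf_neq0.
  by apply: ccontinuousM; [exact: ccontinuous_horner | exact: ccontinuous_cst].
have h0 : complex.Re (h 0) < 0.
  rewrite /h sr0 thk -/c mulNr mulVf// cReN.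
  by rewrite (_ : 1 = real_complex R 1) ?rmorph1//= ltrN10.
have nh : \forall r \near (0 : R), complex.Re (h r) < 0 by exact: (cvgr_lt _ ch).
have nq : \forall r \near (0 : R), q.[sr r] != 0.
  have [c1 c2] : ccontinuous (fun r => q.[sr r]) 0 by exact: ccontinuous_horner.
  have cq : complex.Re q.[sr r] ^+ 2 + complex.Im q.[sr r] ^+ 2 @[r --> (0 : R)] -->
      complex.Re q.[sr 0] ^+ 2 + complex.Im q.[sr 0] ^+ 2.
    by apply: cvgD; apply: cvgM.
  have : 0 < complex.Re q.[sr 0] ^+ 2 + complex.Im q.[sr 0] ^+ 2.
    by rewrite sr0 lt0r sqr_Re_Im_eq0 q0 addr_ge0 ?sqr_ge0.
  by move=> /(cvgr_gt _ cq); apply: filterS => r; rewrite lt0r sqr_Re_Im_eq0 => /andP[].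
near=> r; rewrite -/(sr r).
have r0 : 0 < r by near: r; exact: nbhs_right_gt.
have qr : q.[sr r] != 0 by near: r; exact: cvg_within.
rewrite -subr_lt0 -cReN -cReD.
have -> : p.[sr r] / q.[sr r] - p.[s0] / q.[s0] = N.[sr r] / (q.[sr r] * q.[s0]).
  by rewrite /N !hornerE; field; rewrite q0 qr.
have -> : N.[sr r] = real_complex R (r ^+ k) * th ^+ k * N1.[sr r].
  rewrite NE !(hornerE, horner_exp) mulrC; congr (_ * _).
  by rewrite /sr addrC addKr exprMn rmorphXn.
rewrite -!mulrA -/(h r) cReM cIm_real_complex mul0r subr0.
rewrite pmulr_rlt0; last by rewrite exprn_gt0.
by near: r; exact: cvg_within.
Unshelve. all: by end_near. Qed.

(** A negative value at [s1] would force a negative minimum over a large rectangle in the right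
    half-plane. The sign condition excludes the imaginary axis, the decay condition the other three
    sides, and openness of nonconstant rational functions the interior. *)
Lemma rational_Re_ge0 (p q : {poly R[i]}) :
  (forall s : R[i], 0 <= complex.Re s -> q.[s] != 0) ->
  (forall w : R, 0 <= complex.Re (p.[Complex 0 w] / q.[Complex 0 w])) ->
  (forall e : R, 0 < e -> exists N : R, forall s : R[i],
     0 <= complex.Re s -> N <= `|complex.Re s| \/ N <= `|complex.Im s| ->
     - e < complex.Re (p.[s] / q.[s])) ->
  forall s, 0 <= complex.Re s -> 0 <= complex.Re (p.[s] / q.[s]).
Proof.
move=> qs im_ge0 decay s1 s1_ge0; rewrite leNgt; apply/negP => v1.
pose v s := complex.Re (p.[s] / q.[s]).
have [N0 vN0] := decay (- v s1) (ltac:(by rewrite oppr_gt0)).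
(* Large enough for the rectangle to contain [s1] and for the values on its outer sides to exceed
   [v s1]. *)
pose N := Num.max N0 (Num.max `|complex.Re s1| `|complex.Im s1|) + 1.
have vN s : 0 <= complex.Re s -> N <= `|complex.Re s| \/ N <= `|complex.Im s| -> v s1 < v s.
  move=> s_ge0 sN; rewrite -[v s1]opprK; apply: vN0 => //.
  have N0N : N0 <= N by rewrite /N ler_wpDr// le_max lexx.
  by case: sN => sN; [left|right]; exact: le_trans sN.
pose A : set (R * R) := `[0, N] `*` `[- N, N].
have A1 : A (complex.Re s1, complex.Im s1).
  have [reN imN] : `|complex.Re s1| <= N /\ `|complex.Im s1| <= N.
    by split; rewrite /N ler_wpDr// !le_max lexx !orbT.
  split => /=; rewrite in_itv/= -?ler_norml// s1_ge0/=.
  exact: le_trans (ler_norm _) reN.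
have cA : compact A by apply: compact_setX; exact: segment_compact.
pose f (z : R * R) := v (Complex z.1 z.2).
have cf : {within A, continuous f}.
  rewrite continuous_subspace_in => z /set_mem [/= z1 z2].
  have cz : ccontinuous (fun z : R * R => Complex z.1 z.2) z.
    by split; [exact: cvg_fst|exact: cvg_snd].
  have [cfz _] : ccontinuous (fun z : R * R => p.[Complex z.1 z.2] / q.[Complex z.1 z.2]) z.
    apply: ccontinuousM; first exact: ccontinuous_horner.
    apply: ccontinuousV; last exact: ccontinuous_horner.
    by apply: qs; move: z1; rewrite /= in_itv/= => /andP[].
  by apply: continuous_subspaceT_for => //; split.
have [|[x y] /set_mem [/= xN yN] fmin] := compact_EVT_min _ cA cf.
  by exists (complex.Re s1, complex.Im s1).
pose s0 := Complex x y.
have x_ge0 : 0 <= x by move: xN; rewrite /= in_itv/= => /andP[].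
have v0 : v s0 <= v s1.
  by have := fmin _ (mem_set A1); rewrite /f /=; case: (s1).
have v0_lt0 : v s0 < 0 by exact: le_lt_trans v1.
have x_gt0 : 0 < x.
  rewrite lt_neqAle x_ge0 andbT; apply/eqP => x0.
  by move: v0_lt0; rewrite /v /s0 -x0 ltNge im_ge0.
have xyN : x < N /\ `|y| < N.
  split; rewrite ltNge; apply/negP => le_N; move: v0; rewrite leNgt => /negP; apply.
    by apply: vN => //=; left; rewrite ger0_norm.
  by apply: vN => //=; right.
case: xyN => ltxN; rewrite ltr_norml => /andP[ltNy ltyN].
(* If this polynomial vanishes, [p/q] is constant, and its negative value is also taken at the
   origin, on the imaginary axis. *)
have [N00|Nn0] := eqVneq (p * q.[s0]%:P - q * p.[s0]%:P) 0.
  have /(congr1 (horner^~ (Complex 0 0))) := subr0_eq N00; rewrite !hornerE => e0.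
  have := im_ge0 0; suff -> : p.[Complex 0 0] / q.[Complex 0 0] = p.[s0] / q.[s0].
    by rewrite leNgt v0_lt0.
  by apply/eqP; rewrite eqr_div ?qs//= e0 mulrC.
have [th dec] := rational_Re_decrease (qs s0 x_ge0) Nn0.
have cl (a b : R) : a + r * b @[r --> (0 : R)] --> a + 0 * b.
  by apply: cvgD; [exact: cvg_cst|apply: cvgM; [exact: cvg_id|exact: cvg_cst]].
near (0 : R)^'+ => r.
have : v (s0 + real_complex R r * th) < v s0 by near: r.
rewrite ltNge => /negP; apply.
have Ar : A (x + r * complex.Re th, y + r * complex.Im th).
  split => /=; rewrite in_itv/=; apply/andP; split; apply/ltW; near: r.
  - by apply: cvg_within; apply: (cvgr_gt _ (cl _ _)); rewrite mul0r addr0.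
  - by apply: cvg_within; apply: (cvgr_lt _ (cl _ _)); rewrite mul0r addr0.
  - by apply: cvg_within; apply: (cvgr_gt _ (cl _ _)); rewrite mul0r addr0.
  - by apply: cvg_within; apply: (cvgr_lt _ (cl _ _)); rewrite mul0r addr0.
have := fmin _ (mem_set Ar); rewrite /f /=.
suff -> : s0 + real_complex R r * th =
  Complex (x + r * complex.Re th) (y + r * complex.Im th) by [].
by apply/eqP; rewrite eq_complex cReD cImD cReM cImM /= !mul0r subr0 addr0 !eqxx.
Unshelve. all: by end_near. Qed.

End MinimumPrinciple.

(** * Differential equations on the half-line *)

Section Solutions.
Context {R : realType}.

Definition solves1 (x f : R -> R) : Prop :=
  {within `[0, +oo[, continuous x} /\
  (forall t : R, 0 < t -> is_derive t (1 : R) x (f t)).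

Lemma cvg_mxP T m n (F : set_system T) (FF : Filter F)
    (f : T -> 'M[R]_(m, n)) (M : 'M[R]_(m, n)) :
  f t @[t --> F] --> M <-> forall i j, f t i j @[t --> F] --> M i j.
Proof.
split=> [fM i j|fM].
  exact: (cvg_comp _ _ fM (@coord_continuous R m n i j M)).
apply/cvgrPdist_le => e e0; near=> t.
rewrite /Num.Def.normr/= mx_normrE (bigmax_le _ (ltW e0))//= => -[i j] _.
rewrite !mxE/=; move: i j; near: t.
apply: filter_forall => i; apply: filter_forall => j.
by have /cvgrPdist_le := fM i j; apply.
Unshelve. all: by end_near. Qed.

Lemma solves_coordP n (x f : R -> 'cV[R]_n) :
  solves x f <-> forall i, solves1 (fun t => x t i 0) (fun t => f t i 0).
Proof.
split=> [[cx dx] i|xf].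
  split=> [t|t t0].
    by apply: (cvg_mxP _ _ _).1; exact: cx.
  have [dxt <-] := dx t t0; apply: DeriveDef.
    by move/derivable_mxP: dxt; exact.
  by rewrite derive_mx// mxE.
split=> [t|t t0].
  by apply/cvg_mxP => i j; rewrite (ord1 j); have [+ _] := xf i; exact.
have dx : derivable x t 1.
  apply/derivable_mxP => i j; rewrite (ord1 j).
  by have [_ /(_ t t0)[]] := xf i.
apply: DeriveDef => //; rewrite derive_mx//; apply/matrixP => i j.
by rewrite mxE (ord1 j); have [_ /(_ t t0)[]] := xf i.
Qed.

Lemma solves1_cst (c : R) : solves1 (fun=> c) (fun=> 0).
Proof.
split=> [|t _]; last exact: is_derive_cst.
by apply: continuous_subspaceT => x; exact: cvg_cst.
Qed.

Lemma solves1D (x y f g : R -> R) : solves1 x f -> solves1 y g ->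
  solves1 (fun t => x t + y t) (fun t => f t + g t).
Proof.
move=> [cx dx] [cy dy]; split=> [t|t t0].
  by apply: cvgD; [exact: cx|exact: cy].
by have := dx t t0; have := dy t t0 => *; exact: is_deriveD.
Qed.

Lemma solves1M (x y f g : R -> R) : solves1 x f -> solves1 y g ->
  solves1 (fun t => x t * y t) (fun t => f t * y t + x t * g t).
Proof.
move=> [cx dx] [cy dy]; split=> [t|t t0].
  by apply: cvgM; [exact: cx|exact: cy].
apply: (is_derive_eq (f := x * y)); first exact: is_deriveM (dx t t0) (dy t t0).
by rewrite /GRing.scale/= addrC [y t * _]mulrC.
Qed.

Lemma solves1_sum n (x f : 'I_n -> R -> R) : (forall i, solves1 (x i) (f i)) ->
  solves1 (fun t => \sum_i x i t) (fun t => \sum_i f i t).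
Proof.
move=> xf; elim: n x f xf => [|n ih] x f xf.
  under [X in solves1 X _]eq_fun do rewrite big_ord0.
  under [X in solves1 _ X]eq_fun do rewrite big_ord0.
  exact: solves1_cst.
under [X in solves1 X _]eq_fun do rewrite big_ord_recl.
under [X in solves1 _ X]eq_fun do rewrite big_ord_recl.
by apply: solves1D => //; exact: ih.
Qed.

Lemma solves_eq n (x f g : R -> 'cV[R]_n) :
  (forall t, 0 < t -> f t = g t) -> solves x f -> solves x g.
Proof. by move=> fg [cx dx]; split=> // t t0; rewrite -fg//; exact: dx. Qed.

Lemma solvesD n (x y f g : R -> 'cV[R]_n) : solves x f -> solves y g ->
  solves (fun t => x t + y t) (fun t => f t + g t).
Proof.
move=> /solves_coordP xf /solves_coordP yg; apply/solves_coordP => i.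
under [X in solves1 X _]eq_fun do rewrite mxE.
under [X in solves1 _ X]eq_fun do rewrite mxE.
exact: solves1D.
Qed.

Lemma solves_mulmx n k (C : 'M[R]_(k, n)) (x f : R -> 'cV[R]_n) :
  solves x f -> solves (fun t => C *m x t) (fun t => C *m f t).
Proof.
move=> /solves_coordP xf; apply/solves_coordP => i.
under [X in solves1 X _]eq_fun do rewrite mxE.
under [X in solves1 _ X]eq_fun do rewrite mxE.
apply: solves1_sum => j; have := solves1M (solves1_cst (C i j)) (xf j).
by under [X in solves1 _ X]eq_fun do rewrite mul0r add0r.
Qed.

Lemma solves_dot n (x y f g : R -> 'cV[R]_n) : solves x f -> solves y g ->
  solves1 (fun t => ((x t)^T *m y t) 0 0)
    (fun t => ((f t)^T *m y t) 0 0 + ((x t)^T *m g t) 0 0).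
Proof.
move=> /solves_coordP xf /solves_coordP yg.
have dotE (u v : R -> 'cV[R]_n) t :
    ((u t)^T *m v t) 0 0 = \sum_i u t i 0 * v t i 0.
  by rewrite mxE; apply: eq_bigr => i _; rewrite mxE.
under [X in solves1 X _]eq_fun do rewrite dotE.
under [X in solves1 _ X]eq_fun do rewrite !dotE -big_split/=.
by apply: solves1_sum => i; exact: solves1M.
Qed.

(* [E' <= - c E + h] forces [(E - e) * exp (c t)] to be nonincreasing as soon as
   [h <= c e]. *)
Lemma gronwall_cvg0 (E E' h : R -> R) (c : R) : 0 < c ->
  (forall t : R, 0 < t -> is_derive t (1 : R) E (E' t)) ->
  (forall t : R, 0 < t -> E' t <= - c * E t + h t) ->
  (forall t : R, 0 <= E t) ->
  h t @[t --> +oo] --> (0 : R) -> E t @[t --> +oo] --> (0 : R).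
Proof.
move=> c0 dE E'le E0 h0; apply/cvgrPdist_le => e e0.
(* One half of [e] is reserved for the forcing, the other for the transient. *)
have [T [Treal hT]] : \forall t \near +oo, 0 < t /\ h t <= c * (e / 2).
  near=> t; split; first by near: t; exact: nbhs_pinfty_gt.
  by near: t; apply: (cvgr_le _ h0); rewrite mulr_gt0// divr_gt0.
pose T1 := T + 1.
pose phi t := (E t - e / 2) * expR (c * t).
have dphi t : T < t -> is_derive t (1 : R) phi ((E' t + c * (E t - e / 2)) * expR (c * t)).
  move=> /hT[t0 _]; have := dE t t0 => dEt.
  have dl : is_derive t (1 : R) (c \*: id) c.
    by apply: is_derive_eq; rewrite /GRing.scale/= mulr1.
  have dexp := is_derive1_comp (is_derive_expR (c * t)) dl.
  apply: (is_derive_eq (f := (E - cst (e / 2)) * (expR \o (c \*: id)))).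
  rewrite /GRing.scale/= subr0 /cst.
  by rewrite -[(E - _) t]/(E t - e / 2) -[c *: t]/(c * t); ring.
have phi_le t : T1 <= t -> phi t <= phi T1.
  move=> T1t; apply: (@ler0_derive1_le_cc R phi T1 t); rewrite ?in_itv/= ?lexx ?T1t//.
  - move=> x; rewrite in_itv/= => /andP[T1x _].
    have Tx : T < x by rewrite (lt_trans _ T1x)// ltrDl.
    by have [] := dphi x Tx.
  - move=> x; rewrite in_itv/= => /andP[T1x _].
    have Tx : T < x by rewrite (lt_trans _ T1x)// ltrDl.
    have := dphi x Tx => dphix; rewrite derive1E derive_val.
    have [x0 hx] := hT _ Tx.
    rewrite mulr_le0_ge0 ?expR_ge0//.
    by have := E'le x x0; lra.
  - apply: derivable_within_continuous => x; rewrite in_itv/= => /andP[T1x _].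
    have Tx : T < x by rewrite (lt_le_trans _ T1x)// ltrDl.
    by have [] := dphi x Tx.
near=> t.
have T1t : T1 <= t by near: t; apply: nbhs_pinfty_ge; exact: num_real.
rewrite sub0r normrN ger0_norm//.
have := phi_le _ T1t; rewrite /phi.
have -> : c * t = c * (t - T1) + c * T1 by ring.
rewrite expRD mulrA ler_pM2r ?expR_gt0// => le1.
(* The exponential absorbs the constant [E T1] for large [t], because [1 + x <= expR x]. *)
have le2 : E T1 <= e / 2 * expR (c * (t - T1)).
  apply: le_trans (_ : e / 2 * (c * (t - T1)) <= _); last first.
    rewrite ler_pM2l ?divr_gt0//; apply: le_trans (expR_ge1Dx _).
    by rewrite lerDr.
  rewrite -ler_pdivrMl ?divr_gt0// -ler_pdivrMl// lerBrDr.
  by near: t; apply: nbhs_pinfty_ge; exact: num_real.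
have : (E t - e / 2) * expR (c * (t - T1)) <= e / 2 * expR (c * (t - T1)) by lra.
by rewrite ler_pM2r ?expR_gt0//; lra.
Unshelve. all: by end_near. Qed.

End Solutions.

(** * Decay of stable solutions and the energy of their outputs *)

Section StableSolutions.
Context {R : realType}.

(** This is [z' = r z + f + i g] with [z = a + i b] and [r = al + i be]. The rotation [be] drops out
    of the derivative of [E = |z|^2], and Young's inequality bounds the forcing:
    [E' <= al E + (f^2 + g^2) / (- al)]. *)
Lemma complex_mode_cvg0 (a b f g : R -> R) (al be : R) : al < 0 ->
  (forall t : R, 0 < t -> is_derive t (1 : R) a (al * a t - be * b t + f t)) ->
  (forall t : R, 0 < t -> is_derive t (1 : R) b (be * a t + al * b t + g t)) ->
  f t @[t --> +oo] --> (0 : R) -> g t @[t --> +oo] --> (0 : R) ->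
  a t @[t --> +oo] --> (0 : R) /\ b t @[t --> +oo] --> (0 : R).
Proof.
move=> al0 da db f0 g0.
pose E' t := 2 * (a t * (al * a t - be * b t + f t)) +
  2 * (b t * (be * a t + al * b t + g t)).
have dsq (h : R -> R) (dh t : R) : is_derive t (1 : R) h dh ->
    is_derive t (1 : R) (h * h) (2 * (h t * dh)).
  by move=> d; have := is_deriveM d d; rewrite /GRing.scale/= -mulr2n mulr_natl.
have [E EE dE] : exists2 E : R -> R, forall t, E t = a t ^+ 2 + b t ^+ 2 &
    forall t : R, 0 < t -> is_derive t (1 : R) E (E' t).
  exists (a * a + b * b) => [t|t t0]; first by rewrite !expr2.
  exact: is_deriveD (dsq _ _ _ (da t t0)) (dsq _ _ _ (db t t0)).
have E0 : E t @[t --> +oo] --> (0 : R).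
  apply: (@gronwall_cvg0 R E E'
      (fun t => (f t ^+ 2 + g t ^+ 2) / - al) (- al) _ dE).
  - by rewrite oppr_gt0.
  - move=> t t0; rewrite opprK -lerBlDl ler_pdivlMr ?oppr_gt0// -subr_ge0 EE.
    have -> : f t ^+ 2 + g t ^+ 2 - (E' t - al * (a t ^+ 2 + b t ^+ 2)) * - al =
      (f t + al * a t) ^+ 2 + (g t + al * b t) ^+ 2 by rewrite /E'; ring.
    by rewrite addr_ge0 ?sqr_ge0.
  - by move=> t; rewrite EE addr_ge0 ?sqr_ge0.
  - have : (f t ^+ 2 + g t ^+ 2) / - al @[t --> +oo] --> (0 * 0 + 0 * 0) / - al.
      by apply: cvgM; [apply: cvgD; apply: cvgM|exact: cvg_cst].
    by rewrite mul0r addr0 mul0r.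
have sq (h : R -> R) : (forall t, h t ^+ 2 <= E t) -> h t @[t --> +oo] --> (0 : R).
  move=> hE; apply/cvgrPdist_le => e e0; near=> t.
  rewrite sub0r normrN -(ger0_norm (ltW e0)) -ler_sqr ?nnegrE// !real_normK ?num_real//.
  apply: le_trans (hE t) _; near: t.
  by apply: (cvgr_le _ E0); rewrite exprn_gt0.
by split; apply: sq => t; rewrite EE ?lerDl ?lerDr sqr_ge0.
Unshelve. all: by end_near. Qed.

(** The roots of an annihilating polynomial are peeled off one at a time: [y = c x] satisfies
    [y' = r y + c (M - r) x], so decay of [c (M - r) x] passes to [c x]. The starting point is the
    full product of factors, which is zero. *)
Lemma stable_solution_cvg0 n (M : 'M[R]_n) (x : R -> 'cV[R]_n) : stable_mx M ->
  solves x (fun t => M *m x t) -> x t @[t --> +oo] --> (0 : 'cV[R]_n).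
Proof.
move=> sM xM; have [rs rs_lt0 Mrs] := eigenvalues_annihilate sM.
suff H (c : 'rV[R[i]]_n) :
    ((map_mx (@complex.Re R) c *m x t) 0 0 @[t --> +oo] --> (0 : R)) /\
    ((map_mx (@complex.Im R) c *m x t) 0 0 @[t --> +oo] --> (0 : R)).
  apply/cvg_mxP => i j; rewrite (ord1 j) mxE.
  have [+ _] := H (mxC (delta_mx 0 i)).
  rewrite (_ : (fun t => _) = (fun t => x t i 0))//; apply/funext => t.
  rewrite (_ : map_mx _ _ = delta_mx 0 i); first by rewrite -rowE mxE.
  by apply/matrixP => k l; rewrite !mxE.
have : ((map_mx (@complex.Re R) (c *m foldr (fun r N => (mxC M - r%:M) *m N) 1%:M rs) *m x t) 0 0
      @[t --> +oo] --> (0 : R)) /\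
    ((map_mx (@complex.Im R) (c *m foldr (fun r N => (mxC M - r%:M) *m N) 1%:M rs) *m x t) 0 0
      @[t --> +oo] --> (0 : R)).
  have m0 F : F 0 = 0 :> R -> map_mx F (0 : 'rV[R[i]]_n) = 0.
    by move=> F0; apply/matrixP => i j; rewrite !mxE.
  rewrite Mrs mulmx0 !m0//; split.
    by under eq_fun do rewrite mul0mx mxE; exact: cvg_cst.
  by under eq_fun do rewrite mul0mx mxE; exact: cvg_cst.
elim: rs c rs_lt0 {Mrs} => [|r rs ih] c rs_lt0 /=; first by rewrite mulmx1.
rewrite mulmxA => /ih[|f0 g0]; first by move=> s srs; apply: rs_lt0; rewrite inE srs orbT.
(* Here [F] stands for the real or the imaginary part, so one computation yields both components of
   the mode equation. *)
have split_mode (F : R[i] -> R) (F1 F2 : R) :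
    (forall z, F (r * z) = F1 * complex.Re z + F2 * complex.Im z) ->
    (forall y z, F (y + z) = F y + F z) -> F 0 = 0 ->
    (forall k p q (A : 'M[R[i]]_(k, p)) (B : 'M[R]_(p, q)),
       map_mx F (A *m mxC B) = map_mx F A *m B) ->
  forall t : R, 0 < t -> is_derive t (1 : R) (fun t => (map_mx F c *m x t) 0 0)
    (F1 * (map_mx (@complex.Re R) c *m x t) 0 0 + F2 * (map_mx (@complex.Im R) c *m x t) 0 0 +
     (map_mx F (c *m (mxC M - r%:M)) *m x t) 0 0).
  move=> Fr FD F0 FM t t0.
  have /solves_coordP /(_ 0)[_ /(_ _ t0)] := solves_mulmx (map_mx F c) xM.
  move=> /is_derive_eq; apply.
  rewrite mulmxA -FM (_ : c *m mxC M = r *: c + c *m (mxC M - r%:M)); last first.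
    by rewrite mulmxBr mul_mx_scalar addrC subrK.
  have mFD (A B : 'rV[R[i]]_n) : map_mx F (A + B) = map_mx F A + map_mx F B.
    by apply/matrixP => i j; rewrite !mxE FD.
  rewrite mFD mulmxDl mxE; congr (_ + _).
  have -> : map_mx F (r *: c) = F1 *: map_mx (@complex.Re R) c + F2 *: map_mx (@complex.Im R) c.
    by apply/matrixP => i j; rewrite !mxE Fr.
  by rewrite mulmxDl mxE -!scalemxAl !mxE.
have dRe := split_mode (@complex.Re R) (complex.Re r) (- complex.Im r) _ (@cReD R)
  erefl (fun k p q => @map_Re_mulmxC R k p q).
have dIm := split_mode (@complex.Im R) (complex.Im r) (complex.Re r) _ (@cImD R)
  erefl (fun k p q => @map_Im_mulmxC R k p q).
have r_lt0 : complex.Re r < 0 by apply: rs_lt0; exact: mem_head.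
refine (@complex_mode_cvg0 _ _ _ _ _ (complex.Im r) r_lt0 _ _ f0 g0) => t t0.
- rewrite -mulNr; apply: dRe t0.
  by move=> z; rewrite cReM mulNr.
- apply: dIm t0.
  by move=> z; rewrite cImM addrC.
Qed.

Lemma cvg_mulmx T m n k (F : set_system T) (FF : Filter F)
    (f : T -> 'M[R]_(m, n)) (g : T -> 'M[R]_(n, k)) (M : 'M[R]_(m, n)) (N : 'M[R]_(n, k)) :
  f t @[t --> F] --> M -> g t @[t --> F] --> N ->
  f t *m g t @[t --> F] --> M *m N.
Proof.
move=> /cvg_mxP fM /cvg_mxP gN; apply/cvg_mxP => i j.
under eq_fun do rewrite mxE; rewrite mxE.
by apply: cvg_big => [|l _]; [exact: add_continuous|exact: cvgM].
Qed.

Lemma cvg_trmx T m n (F : set_system T) (FF : Filter F)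
    (f : T -> 'M[R]_(m, n)) (M : 'M[R]_(m, n)) :
  f t @[t --> F] --> M -> (f t)^T @[t --> F] --> M^T.
Proof.
move=> /cvg_mxP fM; apply/cvg_mxP => i j.
by under eq_fun do rewrite mxE; rewrite mxE; exact: fM.
Qed.

Lemma enorm_sqr n (v : 'cV[R]_n) : enorm v ^+ 2 = (v^T *m v) 0 0.
Proof.
rewrite /enorm sqr_sqrtr; last by apply: sumr_ge0 => i _; exact: sqr_ge0.
by rewrite mxE; apply: eq_bigr => i _; rewrite mxE expr2.
Qed.

Definition qform n (X : 'M[R]_n) (v : 'cV[R]_n) : R := (v^T *m X *m v) 0 0.

(** By the Lyapunov equation, [- x^T X x] is an antiderivative of the squared output, and it
    vanishes at infinity by stability. *)
Lemma integral_gramian n k (M X : 'M[R]_n) (C : 'M[R]_(k, n)) (x : R -> 'cV[R]_n) :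
  stable_mx M -> M^T *m X + X *m M = - (C^T *m C) ->
  solves x (fun t => M *m x t) ->
  (\int[lebesgue_measure]_(t in `[0%R, +oo[) (enorm (C *m x t) ^+ 2)%:E)%E =
  (qform X (x 0))%:E.
Proof.
move=> sM MX xM.
pose f t := ((C *m x t)^T *m (C *m x t)) 0 0.
pose F t := ((x t)^T *m (- X *m x t)) 0 0.
have [cF dF] : solves1 F f.
  have := solves_dot xM (solves_mulmx (- X) xM).
  rewrite (_ : (fun t => _ + _) = f)//; apply/funext => t.
  rewrite [RHS](_ : _ = ((x t)^T *m (C^T *m C) *m x t) 0 0); last first.
    by rewrite /f trmx_mul !mulmxA.
  rewrite -[C^T *m C]opprK -MX.
  rewrite [LHS](_ : _ = ((M *m x t)^T *m (- X *m x t) +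
    (x t)^T *m (- X *m (M *m x t))) 0 0); last by rewrite [RHS]mxE.
  congr (fun_of_matrix _ 0 0).
  by rewrite trmx_mul opprD mulmxDr mulmxDl !(mulNmx, mulmxN) !mulmxA.
have [cf _] : solves1 f (fun t => ((C *m (M *m x t))^T *m (C *m x t)) 0 0
   + ((C *m x t)^T *m (C *m (M *m x t))) 0 0).
  by apply: solves_dot; exact: solves_mulmx.
have x0 := stable_solution_cvg0 sM xM.
have F0 : F t @[t --> +oo] --> (0 : R).
  have /cvg_mxP/(_ 0 0) : (x t)^T *m (- X *m x t) @[t --> +oo] -->
      (0 : 'cV[R]_n)^T *m (- X *m 0).
    by apply: cvg_mulmx; [exact: cvg_trmx|apply: cvg_mulmx => //; exact: cvg_cst].
  by rewrite !mulmx0 mxE.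
have [dcF F00] := (continuous_within_itvcyP _ _).1 cF.
under eq_integral do rewrite enorm_sqr -/(f _).
rewrite (ge0_continuous_FTC2y _ cf F0 _ F00).
- by rewrite sub0e -EFinN /F /qform mulNmx mulmxN mxE opprK mulmxA.
- by move=> t _; rewrite /f -enorm_sqr sqr_ge0.
- by move=> t t0; have [] := dF t t0.
- move=> t; rewrite in_itv/= andbT => t0; rewrite derive1E.
  by have := dF t t0 => dFt; rewrite derive_val.
Qed.

Lemma L2norm_gramian n k (M X : 'M[R]_n) (C : 'M[R]_(k, n)) (x : R -> 'cV[R]_n) :
  stable_mx M -> M^T *m X + X *m M = - (C^T *m C) ->
  solves x (fun t => M *m x t) ->
  L2norm (fun t => C *m x t) = (Num.sqrt (qform X (x 0)))%:E.
Proof. by move=> sM MX xM; rewrite /L2norm (integral_gramian sM MX xM). Qed.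

(** * The matrix exponential *)

Section MatrixExponential.
Context {n : nat}.
Implicit Types (M B : 'M[R]_n) (i j : 'I_n).

(** Power series coefficients of an entry of [B] times the exponential of [t M]. The factor [B]
    keeps the family closed under differentiation, which replaces [B] by [B M]. *)
Definition expmx_coef M B i j (k : nat) : R := k`!%:R^-1 * (B *m M ^+ k) i j.

(** With [K] the sum of the absolute values of the entries of [M], the entries of [M^k] are at most
    [K^k], so a scalar exponential series dominates. *)
Lemma norm_expmx_coef M B i j k :
  `|expmx_coef M B i j k| <=
  (\sum_l `|B i l|) * exp_coeff (\sum_i \sum_j `|M i j|) k.
Proof.
set K := \sum_i _.
have Mk l : `|(M ^+ k) l j| <= K ^+ k.
  elim: k l => [|k ih] l; first by rewrite !expr0 mxE; case: (_ == _); rewrite ?normr1 ?normr0.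
  rewrite !exprS -mulmxE mxE (le_trans (ler_norm_sum _ _ _))//.
  rewrite (@le_trans _ _ ((\sum_o `|M l o|) * K ^+ k))//.
    by rewrite mulr_suml ler_sum// => o _; rewrite normrM ler_wpM2l.
  rewrite ler_wpM2r ?exprn_ge0 ?sumr_ge0//.
    by move=> o _; rewrite sumr_ge0.
  rewrite /K [leRHS](bigD1 l)//= lerDl sumr_ge0// => o _; exact: sumr_ge0.
rewrite /expmx_coef /exp_coeff/= normrM ger0_norm ?invr_ge0// mulrC mulrA.
rewrite ler_wpM2r ?invr_ge0// mxE (le_trans (ler_norm_sum _ _ _))//.
by rewrite mulr_suml ler_sum// => o _; rewrite normrM ler_wpM2l.
Qed.

Lemma is_cvg_expmx_coef M B i j (z : R) : cvgn (pseries (expmx_coef M B i j) z).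
Proof.
set b := \sum_l `|B i l|; set K := \sum_i \sum_j `|M i j|.
have K0 : 0 <= K by rewrite sumr_ge0// => l _; rewrite sumr_ge0.
have b0 : 0 <= b by exact: sumr_ge0.
apply: normed_cvg; apply: (@series_le_cvg _ _ (b *: exp_coeff (K * `|z|))) => //.
- by move=> k /=; exact: normr_ge0.
- by move=> k; rewrite -[X in 0 <= X]/(b * _) mulr_ge0// exp_coeff_ge0// mulr_ge0.
- move=> k /=; rewrite normrM normrX.
  have -> : (b *: exp_coeff (K * `|z|)) k = b * exp_coeff K k * `|z| ^+ k.
    by rewrite -[LHS]/(b * exp_coeff (K * `|z|) k) /exp_coeff/= exprMn; ring.
  by rewrite ler_wpM2r ?exprn_ge0 ?norm_expmx_coef.
- exact/is_cvg_seriesZ/is_cvg_series_exp_coeff.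
Qed.

Lemma pseries_diffs_expmx_coef M B i j :
  pseries_diffs (expmx_coef M B i j) = expmx_coef M (B *m M) i j.
Proof.
apply/funext => k; rewrite /pseries_diffs /expmx_coef factS natrM invfM.
rewrite exprS -mulmxE mulmxA !mulrA divff// mul1r//.
Qed.

Lemma expmxE M (t : R) :
  expmx (t *: M) = \matrix_(i, j) limn (pseries (expmx_coef M 1%:M i j) t).
Proof.
apply/cvg_lim => //; apply/cvg_mxP => i j; rewrite mxE.
rewrite (_ : (fun k => _) = pseries (expmx_coef M 1%:M i j) t).
  exact: is_cvg_expmx_coef.
apply/funext => k; rewrite /series/= summxE; apply: eq_bigr => l _.
have -> : (t *: M) ^+ l = t ^+ l *: M ^+ l.
  elim: l => [|l ih]; first by rewrite !expr0 scale1r.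
  by rewrite !exprS ih -!mulmxE -scalemxAl -scalemxAr scalerA.
by rewrite -[RHS]/(expmx_coef M 1%:M i j l * t ^+ l) /expmx_coef mul1mx !mxE mulrA mulrAC.
Qed.

Lemma expmx0 : expmx (0 : 'M[R]_n) = 1%:M.
Proof.
rewrite /expmx; apply: lim_near_cst => //.
near=> k; have /prednK <- : (0 < k)%N by near: k; exact: nbhs_infty_gt.
rewrite /series/= big_nat_recl//= fact0 invr1 scale1r expr0 big1 ?addr0// => l _.
by rewrite expr0n/= scaler0.
Unshelve. all: by end_near. Qed.

(** Termwise differentiation of the entry series replaces the left factor [1] by [M], and linearity
    of the limit pulls [M] out. *)
Lemma expmx_solves M (v : 'cV[R]_n) :
  solves (fun t => expmx (t *: M) *m v) (fun t => M *m (expmx (t *: M) *m v)).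
Proof.
apply/solves_coordP => i.
have limE B j t : limn (pseries (expmx_coef M B i j) t) =
    \sum_l B i l * limn (pseries (expmx_coef M 1%:M l j) t).
  apply/cvg_lim => //.
  have : (\sum_l B i l * pseries (expmx_coef M 1%:M l j) t k) @[k --> \oo] -->
      \sum_l B i l * limn (pseries (expmx_coef M 1%:M l j) t).
    apply: cvg_big => [|l _]; first exact: add_continuous.
    by apply: cvgM; [exact: cvg_cst|exact: is_cvg_expmx_coef].
  rewrite (_ : (fun k => _) = pseries (expmx_coef M B i j) t)//.
  apply/funext => k; rewrite /pseries/series/=.
  under eq_bigr do rewrite mulr_sumr.
  rewrite exchange_big/=; apply: eq_bigr => o _.
  rewrite {2}/expmx_coef mxE mulr_sumr mulr_suml; apply: eq_bigr => l _.
  by rewrite /expmx_coef mul1mx; ring.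
have dE j t : is_derive t (1 : R) (fun t => limn (pseries (expmx_coef M 1%:M i j) t))
    (limn (pseries (expmx_coef M M i j) t)).
  (* Termwise differentiation at [t] asks for convergence at a point of larger modulus. *)
  have := @pseries_snd_diffs R (expmx_coef M 1%:M i j) (`|t| + 1) t.
  rewrite !pseries_diffs_expmx_coef mul1mx; apply; try exact: is_cvg_expmx_coef.
  by rewrite [ltRHS]ger0_norm ?addr_ge0// ltrDl.
have sE j : solves1 (fun t => limn (pseries (expmx_coef M 1%:M i j) t))
    (fun t => limn (pseries (expmx_coef M M i j) t)).
  split=> [|t _]; last exact: dE.
  apply: continuous_subspaceT => t; apply: differentiable_continuous.
  by apply/derivable1_diffP; have [] := dE j t.
have xE t : (expmx (t *: M) *m v) i 0 =
    \sum_j limn (pseries (expmx_coef M 1%:M i j) t) * v j 0.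
  by rewrite expmxE mxE; apply: eq_bigr => j _; rewrite mxE.
have dxE t : (M *m (expmx (t *: M) *m v)) i 0 =
    \sum_j (limn (pseries (expmx_coef M M i j) t) * v j 0 +
      limn (pseries (expmx_coef M 1%:M i j) t) * 0).
  rewrite mulmxA expmxE mxE; apply: eq_bigr => j _; rewrite mulr0 addr0 limE mxE.
  by congr (_ * _); apply: eq_bigr => l _; rewrite mxE.
under [X in solves1 X _]eq_fun do rewrite xE.
under [X in solves1 _ X]eq_fun do rewrite dxE.
by apply: solves1_sum => j; apply: solves1M => //; exact: solves1_cst.
Qed.

End MatrixExponential.

End StableSolutions.

(** * Resolvents at infinity and on the imaginary axis *)

Section PositiveReal.
Context {R : realType}.

(** From [s a = w + M a], the sum [S] of the moduli of the entries of [a] satisfies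
    [|s| S <= W + K S], so it is of order [1/|s|] at infinity. *)
Lemma resolvent_vanishes n (M : 'M[R]_n) (w : 'cV[R]_n) (r : 'rV[R]_n) (e : R) : 0 < e ->
  exists N : R, forall (s : R[i]) (a : 'cV[R[i]]_n),
    N <= `|complex.Re s| \/ N <= `|complex.Im s| ->
    (s%:M - mxC M) *m a = mxC w ->
    `|complex.Re ((mxC r *m a) 0 0)| < e.
Proof.
move=> e0.
(* The modulus as an element of [R], so that the estimates take place there. *)
pose nrm (z : R[i]) : R := Num.sqrt (complex.Re z ^+ 2 + complex.Im z ^+ 2).
have nrmE z : `|z| = real_complex R (nrm z) by rewrite normc_def.
have nrmD y z : nrm (y + z) <= nrm y + nrm z.
  by rewrite -lecR -nrmE rmorphD/= -!nrmE ler_normD.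
have nrmM y z : nrm (y * z) = nrm y * nrm z.
  by apply: (@complexI R); rewrite -nrmE rmorphM/= -!nrmE normrM.
have nrm_ge0 z : 0 <= nrm z by exact: sqrtr_ge0.
have nrmR x : nrm (real_complex R x) = `|x|.
  by rewrite /nrm /= expr0n addr0 sqrtr_sqr.
have nrm_sum (F : 'I_n -> R[i]) : nrm (\sum_i F i) <= \sum_i nrm (F i).
  elim/big_ind2 : _ => [|x1 x2 y1 y2 h1 h2|//]; last exact: le_trans (lerD h1 h2).
  by rewrite -(rmorph0 (real_complex R)) nrmR normr0.
have Re_nrm z : `|complex.Re z| <= nrm z.
  by rewrite -sqrtr_sqr ler_sqrt ?addr_ge0 ?sqr_ge0// lerDl sqr_ge0.
have Im_nrm z : `|complex.Im z| <= nrm z.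
  by rewrite -sqrtr_sqr ler_sqrt ?addr_ge0 ?sqr_ge0// lerDr sqr_ge0.
pose W := \sum_i `|w i 0|; pose K := \sum_i \sum_j `|M i j|; pose C := \sum_i `|r 0 i|.
have W0 : 0 <= W by exact: sumr_ge0.
have C0 : 0 <= C by exact: sumr_ge0.
(* For [|s|] above this threshold, [(1 + C W / e) S <= W], whence [C S < e]. *)
exists (K + 1 + C * W / e) => s a sN sa.
pose S := \sum_i nrm (a i 0).
have S0 : 0 <= S by exact: sumr_ge0.
have aS i : nrm (a i 0) <= S by rewrite /S (bigD1 i)//= lerDl sumr_ge0.
have sle : nrm s * S <= W + K * S.
  rewrite mulr_sumr mulr_suml -big_split/=; apply: ler_sum => i _.
  rewrite -nrmM (_ : s * a i 0 = real_complex R (w i 0) + \sum_j real_complex R (M i j) * a j 0).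
    apply: le_trans (nrmD _ _) _; rewrite nrmR lerD2l mulr_suml.
    apply: le_trans (nrm_sum _) _; apply: ler_sum => j _.
    by rewrite nrmM nrmR ler_wpM2l.
  have /matrixP/(_ i 0) := sa; rewrite mulmxBl mul_scalar_mx !mxE => <-.
  rewrite [X in _ + X](eq_bigr (fun j => mxC M i j * a j 0)) ?subrK// => j _.
  by rewrite mxE.
have CS : nrm ((mxC r *m a) 0 0) <= C * S.
  rewrite mxE mulr_suml; apply: le_trans (nrm_sum _) _; apply: ler_sum => j _.
  by rewrite nrmM mxE nrmR ler_wpM2l.
have sN' : K + 1 + C * W / e <= nrm s by case: sN => /le_trans; apply.
apply: le_lt_trans (Re_nrm _) _; apply: le_lt_trans CS _.
have : (1 + C * W / e) * S <= W by nra.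
move=> le1.
have [->|Cn0] := eqVneq C 0; first by rewrite mul0r.
have Cpos : 0 < C by rewrite lt0r Cn0.
have : C * ((1 + C * W / e) * S) <= C * W by rewrite ler_pM2l.
have -> : C * ((1 + C * W / e) * S) = C * S * (1 + C * W / e) by ring.
have D0 : 0 < 1 + C * W / e by rewrite ltr_pwDl// divr_ge0 ?mulr_ge0// ltW.
rewrite -ler_pdivlMr// => /le_lt_trans; apply.
rewrite ltr_pdivrMr// mulrDr mulr1 mulrCA divff ?gt_eqF// mulr1.
by rewrite ltrDr.
Qed.

(* With [s = i w] and [a + i b = (s - M)^-1 v], real parts give
   [- w b - M a = v] and [w a - M b = 0], so [a^T Q a + b^T Q b = 2 a^T X v]
   where [Q = - (M^T X + X M)]. *)
Lemma lyapunov_resolvent n (M X Q : 'M[R]_n) (v : 'cV[R]_n) (w : R) (a : 'cV[R[i]]_n) :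
  X^T = X -> M^T *m X + X *m M = - Q ->
  ((Complex 0 w)%:M - mxC M) *m a = mxC v ->
  qform Q (map_mx (@complex.Re R) a) + qform Q (map_mx (@complex.Im R) a) =
  2 * complex.Re ((mxC (v^T *m X) *m a) 0 0).
Proof.
move=> XT MX; set al := map_mx (@complex.Re R) a; set be := map_mx (@complex.Im R) a.
move=> eq_a.
have e1 : M *m al = - (w *: be) - v.
  have := congr1 (map_mx (@complex.Re R)) eq_a.
  rewrite mulmxBl mul_scalar_mx => /matrixP h; apply/matrixP => i j.
  have := h i j; rewrite [LHS]mxE [X in complex.Re X = _]mxE cReD.
  rewrite [X in complex.Re X + _]mxE [X in _ + complex.Re X]mxE cReN.
  rewrite cReM/= mul0r sub0r.
  have -> : complex.Re ((mxC M *m a) i j) = (M *m al) i j.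
    by rewrite /al -map_Re_mxCmul [RHS]mxE.
  move: (M *m al) => p; rewrite !mxE /= => <-; ring.
have e2 : M *m be = w *: al.
  have := congr1 (map_mx (@complex.Im R)) eq_a.
  rewrite mulmxBl mul_scalar_mx => /matrixP h; apply/matrixP => i j.
  have := h i j; rewrite [LHS]mxE [X in complex.Im X = _]mxE cImD.
  rewrite [X in complex.Im X + _]mxE [X in _ + complex.Im X]mxE.
  rewrite cImM/= mul0r add0r.
  have -> : complex.Im (- (mxC M *m a) i j) = - (M *m be) i j.
    by rewrite /be -map_Im_mxCmul [in RHS]mxE; case: (_ i j).
  by move: (M *m be) => p; rewrite !mxE /= => h0; apply/esym/subr0_eq.
(* As [X] is symmetric, [M^T X] and [X M] contribute equally. *)
have qE (u : 'cV[R]_n) : qform Q u = - (2 * (u^T *m X *m (M *m u)) 0 0).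
  rewrite /qform -[Q]opprK -MX mulmxN mulNmx mxE; congr (- _).
  rewrite mulmxDr mulmxDl mxE mulr_natl mulr2n !mulmxA; congr (_ + _).
  have -> : u^T *m M^T *m X *m u = (u^T *m X *m M *m u)^T.
    by rewrite !trmx_mul trmxK XT !mulmxA.
  by rewrite mxE.
have ReE : complex.Re ((mxC (v^T *m X) *m a) 0 0) = (v^T *m X *m al) 0 0.
  by rewrite /al -map_Re_mxCmul [RHS]mxE.
have sym (u u' : 'cV[R]_n) : (u^T *m X *m u') 0 0 = (u'^T *m X *m u) 0 0.
  have -> : u^T *m X *m u' = (u'^T *m X *m u)^T.
    by rewrite !trmx_mul trmxK XT mulmxA.
  by rewrite mxE.
(* The cross terms [w al^T X be] of the two quadratic forms cancel. *)
rewrite !qE ReE e1 e2 (sym v).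
have -> : (al^T *m X *m (- (w *: be) - v)) 0 0 =
    - (w * (al^T *m X *m be) 0 0) - (al^T *m X *m v) 0 0.
  rewrite mulmxBr mulmxN -scalemxAr.
  by move: (al^T *m X *m be) (al^T *m X *m v) => p q; rewrite !mxE.
have -> : (be^T *m X *m (w *: al)) 0 0 = w * (al^T *m X *m be) 0 0.
  by rewrite -sym linearZ/= -!scalemxAl mxE.
ring.
Qed.

End PositiveReal.

(** * Comparison of Gramians from a frequency-wise inequality *)

Section GramianComparison.
Context {R : realType}.

Lemma enormC_sqr n (u : 'cV[R[i]]_n) : enormC u ^+ 2 =
  enorm (map_mx (@complex.Re R) u) ^+ 2 + enorm (map_mx (@complex.Im R) u) ^+ 2.
Proof.
rewrite /enormC /enorm !sqr_sqrtr ?sumr_ge0// => [|i _|i _|i _]; last first.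
- by rewrite addr_ge0 ?sqr_ge0.
- exact: sqr_ge0.
- exact: sqr_ge0.
by rewrite -big_split; apply: eq_bigr => i _; rewrite !mxE.
Qed.

Lemma qform_trmx_mul n k (C : 'M[R]_(k, n)) (u : 'cV[R]_n) :
  qform (C^T *m C) u = enorm (C *m u) ^+ 2.
Proof. by rewrite enorm_sqr /qform trmx_mul !mulmxA. Qed.

Lemma qformB n (X Y : 'M[R]_n) (u : 'cV[R]_n) :
  qform (X - Y) u = qform X u - qform Y u.
Proof. by rewrite /qform mulmxBr mulmxBl !mxE. Qed.

Lemma qformZ n (c : R) (X : 'M[R]_n) (u : 'cV[R]_n) :
  qform (c *: X) u = c * qform X u.
Proof. by rewrite /qform -scalemxAr -scalemxAl mxE. Qed.

(** By Cramer's rule the resolvent is the adjugate of [s - M] over the characteristic polynomial, so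
    its coefficients are rational in [s]. *)
Lemma resolvent_rational n (M : 'M[R]_n) (r : 'rV[R]_n) (v : 'cV[R]_n) :
  exists p : {poly R[i]}, forall s, (char_poly (mxC M)).[s] != 0 ->
  exists2 a : 'cV[R[i]]_n, (s%:M - mxC M) *m a = mxC v &
    p.[s] / (char_poly (mxC M)).[s] = (mxC r *m a) 0 0.
Proof.
pose A := char_poly_mx (mxC M).
exists ((map_mx polyC (mxC r) *m \adj A *m map_mx polyC (mxC v)) 0 0) => s qs.
pose h := horner_eval s.
have hC m k (N : 'M[R[i]]_(m, k)) : map_mx h (map_mx polyC N) = N.
  by apply/matrixP => i j; rewrite !mxE /h /horner_eval hornerC.
have hA : map_mx h A = s%:M - mxC M.
  apply/matrixP => i j; rewrite !mxE /h /horner_eval !hornerE.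
  by rewrite hornerMn hornerX.
pose a := (char_poly (mxC M)).[s]^-1 *: (map_mx h (\adj A) *m mxC v).
exists a.
  rewrite /a -scalemxAr mulmxA -hA -map_mxM mul_mx_adj map_scalar_mx/=.
  by rewrite mul_scalar_mx scalerA mulVf ?scale1r.
rewrite /a -scalemxAr [RHS]mxE [RHS]mulrC; congr (_ / _).
rewrite -[LHS]/(h _) mulmxA; transitivity ((map_mx h (map_mx polyC (mxC r) *m \adj A *m
  map_mx polyC (mxC v))) 0 0); first by rewrite [RHS]mxE.
by rewrite !map_mxM !hC.
Qed.

(* On the imaginary axis the real part of [v^T Z (s - M)^-1 v], where
   [Z = g^2 Y - X], equals half of [g^2 |D a|^2 - |C a|^2]; by the minimum
   principle it is then nonnegative on the positive real axis, and [v^T Z v] is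
   its leading coefficient at infinity. *)
Lemma gramian_le n k l (M X Y : 'M[R]_n) (C : 'M[R]_(k, n)) (D : 'M[R]_(l, n))
    (g : R) (v : 'cV[R]_n) :
  stable_mx M -> X^T = X -> Y^T = Y ->
  M^T *m X + X *m M = - (C^T *m C) -> M^T *m Y + Y *m M = - (D^T *m D) ->
  (forall (w : R) (a : 'cV[R[i]]_n), ((Complex 0 w)%:M - mxC M) *m a = mxC v ->
    enormC (mxC C *m a) ^+ 2 <= g ^+ 2 * enormC (mxC D *m a) ^+ 2) ->
  qform X v <= g ^+ 2 * qform Y v.
Proof.
move=> sM XT YT MX MY CD.
pose Z := g ^+ 2 *: Y - X.
have ZT : Z^T = Z by rewrite /Z linearB/= linearZ/= XT YT.
have MZ : M^T *m Z + Z *m M = - (g ^+ 2 *: (D^T *m D) - C^T *m C).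
  rewrite /Z mulmxBr mulmxBl -scalemxAr -scalemxAl addrACA -scalerDr MY.
  by rewrite -opprD MX scalerN opprK opprB addrC.
rewrite -subr_ge0 -qformZ -qformB -/Z leNgt; clearbody Z; apply/negP => Zv.
have [p pE] := resolvent_rational M (v^T *m Z) v.
(* Stability keeps the poles out of the closed right half-plane. *)
have q_neq0 s : 0 <= complex.Re s -> (char_poly (mxC M)).[s] != 0.
  move=> s0; have := stable_mx_unit sM s0.
  by rewrite eigenvalue_unitmx eigenvalue_root_char.
have re_ge0 : forall s, 0 <= complex.Re s -> 0 <= complex.Re (p.[s] / (char_poly (mxC M)).[s]).
  apply: rational_Re_ge0 => [//|w|e e0].
    have [a sa ->] := pE _ (q_neq0 (Complex 0 w) (lexx _)).
    rewrite -(pmulr_rge0 _ (ltr0Sn _ 1)) -(lyapunov_resolvent ZT MZ sa).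
    rewrite !qformB !qformZ !qform_trmx_mul addrACA -mulrDr -opprD subr_ge0.
    by have := CD w a sa; rewrite !enormC_sqr !map_Re_mxCmul !map_Im_mxCmul.
  have [N HN] := resolvent_vanishes M v (v^T *m Z) e0.
  exists N => s s0 sN; have [a sa ->] := pE _ (q_neq0 _ s0).
  by have := HN s a sN sa; rewrite ltr_norml => /andP[].
(* From [s a = v + M a] one gets [s v^T Z a = v^T Z v + v^T Z M a]. The last term vanishes at
   infinity, so a negative [v^T Z v] makes the real part negative at a large real [s]. *)
have [N HN] := resolvent_vanishes M v (v^T *m Z *m M)
  (ltac:(by rewrite oppr_gt0) : 0 < - qform Z v).
pose s : R := Num.max 1 N.
have s0 : 0 < s by rewrite lt_max ltr01.
have [a sa paE] := pE _ (q_neq0 (real_complex R s) (ltW s0)).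
have := re_ge0 (real_complex R s) (ltW s0); rewrite paE.
rewrite -(pmulr_rge0 _ s0) leNgt => /negP; apply.
have -> : s * complex.Re ((mxC (v^T *m Z) *m a) 0 0) =
    qform Z v + complex.Re ((mxC (v^T *m Z *m M) *m a) 0 0).
  have -> : mxC (v^T *m Z *m M) *m a =
      real_complex R s *: (mxC (v^T *m Z) *m a) - mxC (v^T *m Z *m v).
    rewrite [mxC (_ *m v)]mxC_mul -sa mulmxBl mulmxBr mul_scalar_mx -scalemxAr.
    by rewrite opprB addrC subrK [mxC (_ *m M)]mxC_mul mulmxA.
  rewrite [X in _ + complex.Re X]mxE cReD [X in complex.Re X + _]mxE cReM/= mul0r subr0.
  have -> : complex.Re ((- mxC (v^T *m Z *m v)) 0 0) = - qform Z v.
    by rewrite /qform; move: (v^T *m Z *m v) => u; rewrite !mxE.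
  by rewrite addrC subrK.
have sN : N <= `|complex.Re (real_complex R s)| \/ N <= `|complex.Im (real_complex R s)|.
  by left; rewrite /= (ger0_norm (ltW s0)) /s le_max lexx orbT.
have := HN _ _ sN sa; rewrite ltr_norml => /andP[_].
by rewrite -ltrBrDl sub0r.
Qed.

End GramianComparison.

(** * Superposition of responses and the H-infinity norm *)

Section Superposition.
Context {R : realType}.

(** The form is the output energy of the solution that starts at [v]. *)
Lemma gramian_ge0 n k (M X : 'M[R]_n) (C : 'M[R]_(k, n)) (v : 'cV[R]_n) :
  stable_mx M -> M^T *m X + X *m M = - (C^T *m C) -> 0 <= qform X v.
Proof.
move=> sM MX; have := integral_gramian sM MX (expmx_solves M v).
rewrite scale0r expmx0 mul1mx -lee_fin => <-.
by apply: integral_ge0 => t _; rewrite lee_fin sqr_ge0.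
Qed.

(** The quadratic polynomial [qform X (u + t v)] in [t] is nonnegative; this yields Cauchy-Schwarz
    and then the triangle inequality. *)
Lemma sqrt_qformD n (X : 'M[R]_n) (u v : 'cV[R]_n) : X^T = X ->
  (forall w : 'cV[R]_n, 0 <= qform X w) ->
  Num.sqrt (qform X (u + v)) <= Num.sqrt (qform X u) + Num.sqrt (qform X v).
Proof.
move=> XT X0; pose b := (u^T *m X *m v) 0 0.
have qE (t : R) : qform X (u + t *: v) = qform X v * t ^+ 2 + (2 * b) * t + qform X u.
  have vu : (v^T *m X *m u) 0 0 = b.
    have -> : v^T *m X *m u = (u^T *m X *m v)^T by rewrite !trmx_mul trmxK XT mulmxA.
    by rewrite mxE.
  rewrite /qform (_ : (u + t *: v)^T = u^T + t *: v^T); last by rewrite linearD linearZ.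
  rewrite !(mulmxDl, mulmxDr) -!scalemxAl -!scalemxAr.
  move: vu; rewrite /b; move: (u^T *m X *m u) (u^T *m X *m v) (v^T *m X *m u) (v^T *m X *m v).
  by move=> p q r s vu; rewrite !mxE vu; ring.
have cs : b ^+ 2 <= qform X u * qform X v.
  have q_ge0 (t : R) : 0 <= qform X v * t ^+ 2 + (2 * b) * t + qform X u by rewrite -qE.
  have [v0|v_neq0] := eqVneq (qform X v) 0.
    have [->|b0] := eqVneq b 0; first by rewrite v0 expr0n mulr0.
    (* With no quadratic term and [b] nonzero, the polynomial takes the value [-1] at this point. *)
    have := q_ge0 (- (qform X u + 1) / (2 * b)).
    rewrite v0 mul0r add0r mulrC divfK ?mulf_neq0// ?pnatr_eq0//.
    by rewrite opprD addrAC addNr add0r oppr_ge0 leNgt ltr01.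
  have v_gt0 : 0 < qform X v by rewrite lt0r v_neq0 X0.
  (* The minimizer of the polynomial. *)
  have := q_ge0 (- b / qform X v).
  have -> : qform X v * (- b / qform X v) ^+ 2 + 2 * b * (- b / qform X v) + qform X u =
      qform X u - b ^+ 2 / qform X v by field.
  by rewrite subr_ge0 ler_pdivrMr.
rewrite -ler_sqr ?nnegrE ?addr_ge0 ?sqrtr_ge0// sqrrD !sqr_sqrtr//.
have := qE 1; rewrite scale1r => ->; rewrite expr1n !mulr1.
rewrite -sqrtrM// -mulr_natl.
have : b <= Num.sqrt (qform X u * qform X v).
  by apply: le_trans (ler_norm _) _; rewrite -sqrtr_sqr ler_sqrt// mulr_ge0.
lra.
Qed.

Lemma L2norm_ge0 n (f : R -> 'cV[R]_n) : (0 <= L2norm f)%E.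
Proof. exact: sqrte_ge0. Qed.

(** An output norm is a seminorm of the initial state, given by a Gramian. The triangle inequality
    splits off [xa], and the frequency-wise hypothesis compares the outputs [C] and [D] of [xb]. *)
Lemma L2norm_superposition n k l (M : 'M[R]_n) (C : 'M[R]_(k, n)) (D : 'M[R]_(l, n))
    (g : R) (x xa xb : R -> 'cV[R]_n) :
  stable_mx M -> 0 <= g ->
  solves x (fun t => M *m x t) -> solves xa (fun t => M *m xa t) ->
  solves xb (fun t => M *m xb t) -> x 0 = xa 0 + xb 0 ->
  (forall (w : R) (a : 'cV[R[i]]_n), ((Complex 0 w)%:M - mxC M) *m a = mxC (xb 0) ->
    enormC (mxC C *m a) <= g * enormC (mxC D *m a)) ->
  (L2norm (fun t => C *m x t) <=
   g%:E * L2norm (fun t => D *m xb t) + L2norm (fun t => C *m xa t))%E.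
Proof.
move=> sM g0 xM xaM xbM x0 CD.
have sym k' (H : 'M[R]_(k', n)) : (H^T *m H)^T = H^T *m H by rewrite trmx_mul trmxK.
have [X XT MX] := lyapunov_solution sM (sym _ C).
have [Y YT MY] := lyapunov_solution sM (sym _ D).
rewrite (L2norm_gramian sM MX xM) (L2norm_gramian sM MX xaM) (L2norm_gramian sM MY xbM).
rewrite -EFinM -EFinD lee_fin x0 addrC.
apply: le_trans (sqrt_qformD _ _ XT (fun w => gramian_ge0 w sM MX)) _.
rewrite lerD2r -[g]ger0_norm// -sqrtr_sqr -sqrtrM ?sqr_ge0// ler_sqrt; last first.
  by rewrite mulr_ge0 ?sqr_ge0// (gramian_ge0 _ sM MY).
apply: (gramian_le sM XT YT MX MY) => w a /CD; rewrite -exprMn ler_sqr// nnegrE.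
  exact: sqrtr_ge0.
by rewrite mulr_ge0// sqrtr_ge0.
Qed.

Lemma enormCZ n (c : R) (u : 'cV[R[i]]_n) : 0 <= c ->
  enormC (real_complex R c *: u) = c * enormC u.
Proof.
move=> c0; rewrite /enormC -[X in X * _]ger0_norm// -[X in X * _]sqrtr_sqr -sqrtrM ?sqr_ge0//.
congr Num.sqrt; rewrite mulr_sumr; apply: eq_bigr => i _.
by rewrite mxE cReM cImM/= !mul0r subr0 addr0 !exprMn mulrDr.
Qed.

Lemma Hinf_norm_ge0 m n (G : R[i] -> 'M[R[i]]_(m, n)) : (0 <= Hinf_norm G)%E.
Proof.
apply: (@le_trans _ _ (spectral_norm (G (Complex 0 0)))); last first.
  by apply: ereal_sup_ubound; exists 0.
apply: (@le_trans _ _ (enormC (G (Complex 0 0) *m 0))%:E).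
  by rewrite lee_fin sqrtr_ge0.
apply: ereal_sup_ubound; exists 0 => //=.
by rewrite /enormC big1 ?sqrtr0 ?ler01// => i _; rewrite mxE/= expr0n addr0.
Qed.

Lemma Hinf_norm_bound m n (G : R[i] -> 'M[R[i]]_(m, n)) (g w : R) (u : 'cV[R[i]]_n) :
  Hinf_norm G = g%:E -> enormC (G (Complex 0 w) *m u) <= g * enormC u.
Proof.
move=> Gg.
have G1 (v : 'cV[R[i]]_n) : enormC v <= 1 -> enormC (G (Complex 0 w) *m v) <= g.
  move=> v1; rewrite -lee_fin -Gg.
  apply: (@le_trans _ _ (spectral_norm (G (Complex 0 w)))); last first.
    by apply: ereal_sup_ubound; exists w.
  by apply: ereal_sup_ubound; exists v.
(* Scaling [u] into the unit ball divides by its norm; when that is zero, [u] itself is zero. *)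
have [u0|u_neq0] := eqVneq (enormC u) 0.
  have -> : u = 0.
    have re_im i : 0 <= complex.Re (u i 0) ^+ 2 + complex.Im (u i 0) ^+ 2.
      by rewrite addr_ge0 ?sqr_ge0.
    have /eqP : enormC u ^+ 2 = 0 by rewrite u0 expr0n.
    rewrite sqr_sqrtr ?sumr_ge0// psumr_eq0// => /allP u0'.
    apply/matrixP => i j; rewrite (ord1 j) mxE; apply/eqP.
    by rewrite -sqr_Re_Im_eq0; apply: u0'; rewrite mem_index_enum.
  have e0 k : enormC (0 : 'cV[R[i]]_k) = 0.
    by rewrite /enormC big1 ?sqrtr0// => i _; rewrite mxE/= expr0n addr0.
  by rewrite mulmx0 !e0 mulr0.
have u_gt0 : 0 < enormC u by rewrite lt0r u_neq0 sqrtr_ge0.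
have := G1 (real_complex R (enormC u)^-1 *: u).
rewrite -scalemxAr !enormCZ ?invr_ge0 ?sqrtr_ge0// mulVf// => /(_ (lexx _)).
by rewrite ler_pdivrMl// mulrC.
Qed.

End Superposition.

(** * The closed loop as a cascade *)

Section ClosedLoop.
Context {R : realType} {n1 n2 nh m p1 p2 : nat}.
Variables (A1 : 'M[R]_n1) (B1 : 'M[R]_(n1, m)) (L1 : 'M[R]_(n1, p1)).
Variables (A2 : 'M[R]_n2) (L2 : 'M[R]_(n2, p2)).
Variables (Gam1 : 'M[R]_(p2, n1)) (Gam2 : 'M[R]_(p1, n2)).
Variables (P1 : 'M[R]_(n1, nh)) (P1d : 'M[R]_(nh, n1)).
Variables (Pb : 'M[R]_(n1, n1 - nh)) (Pbd : 'M[R]_(n1 - nh, n1)).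
Variable (K : 'M[R]_(m, nh)).
Hypotheses (hP1 : P1d *m P1 = 1%:M) (hB1 : P1 *m P1d *m B1 = B1).
Hypotheses (hL1 : P1d *m L1 = 0) (hPPb : P1 *m P1d + Pb *m Pbd = 1%:M).

Local Notation A := (sys_mx A1 L1 A2 L2 Gam1 Gam2).
Local Notation F := (P1d *m A1 *m P1 + P1d *m B1 *m K).

(** The constant input matrix of [transfer]; [P1 xi] acts on [(z1, x2)] through it. *)
Definition perturbation_mx : 'M[R]_(n1 + n2, n1) :=
  E1 n1 n2 *m Pb *m Pbd *m A1 + E2 n1 n2 *m L2 *m Gam1.

Definition cascade_mx : 'M[R]_(n1 + n2 + nh) :=
  block_mx A (perturbation_mx *m P1) 0 F.

(* [(x1, x2, xh) |-> (x1 - P1 xi, x2, xi)] with [xi = P1d x1 - xh]. *)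
Definition to_cascade : 'M[R]_(n1 + n2 + nh) :=
  block_mx (block_mx (Pb *m Pbd) 0 0 1%:M) (col_mx P1 0) (row_mx P1d 0) (- 1%:M).

(** The inverse change of coordinates: [P1d] kills [Pb Pbd], hence sends [z1 = Pb Pbd x1 + P1 xh]
    back to [xh]. *)
Definition of_cascade : 'M[R]_(n1 + n2 + nh) :=
  block_mx 1%:M (col_mx P1 0) (row_mx P1d 0) 0.

Lemma eq_mulmx_col k l (M N : 'M[R]_(k, l)) :
  (forall v : 'cV[R]_l, M *m v = N *m v) -> M = N.
Proof.
by move=> MN; apply/matrixP => i j; have /matrixP/(_ i 0) := MN (delta_mx j 0); rewrite -!colE !mxE.
Qed.

Lemma to_cascadeE (x1 : 'cV[R]_n1) (x2 : 'cV[R]_n2) (xh : 'cV[R]_nh) :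
  to_cascade *m col_mx (col_mx x1 x2) xh =
  col_mx (col_mx (Pb *m Pbd *m x1 + P1 *m xh) x2) (P1d *m x1 - xh).
Proof.
rewrite /to_cascade !(mul_block_col, mul_col_mx, mul_row_col) add_col_mx.
by rewrite !mul0mx !mul1mx !addr0 add0r mulNmx mul1mx.
Qed.

Lemma of_cascadeE (z1 : 'cV[R]_n1) (x2 : 'cV[R]_n2) (xi : 'cV[R]_nh) :
  of_cascade *m col_mx (col_mx z1 x2) xi =
  col_mx (col_mx (z1 + P1 *m xi) x2) (P1d *m z1).
Proof.
rewrite /of_cascade !(mul_block_col, mul_col_mx, mul_row_col) mul1mx add_col_mx.
by rewrite !mul0mx !addr0.
Qed.

Lemma cascade_mxE (z1 : 'cV[R]_n1) (x2 : 'cV[R]_n2) (xi : 'cV[R]_nh) :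
  cascade_mx *m col_mx (col_mx z1 x2) xi =
  col_mx (col_mx (A1 *m z1 + L1 *m Gam2 *m x2 + Pb *m Pbd *m A1 *m P1 *m xi)
                 (A2 *m x2 + L2 *m Gam1 *m (z1 + P1 *m xi)))
         (F *m xi).
Proof.
rewrite /cascade_mx /sys_mx /perturbation_mx /E1 /E2.
rewrite !(mul_block_col, mul_col_mx, mul0mx, mul1mx, add_col_mx, addr0, add0r).
congr (col_mx (col_mx _ _) _).
by rewrite mulmxDr !mulmxA addrCA addrA.
Qed.

Lemma P1d_Pb : P1d *m Pb *m Pbd = 0.
Proof.
have := congr1 (mulmx P1d) hPPb.
rewrite mulmxDr mulmx1 mulmxA hP1 mul1mx mulmxA.
by move/eqP; rewrite eq_sym -subr_eq0 opprD addrA subrr sub0r oppr_eq0 => /eqP.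
Qed.

Lemma of_cascadeK : of_cascade *m to_cascade = 1%:M.
Proof.
apply: eq_mulmx_col => v; rewrite -[v]vsubmxK -[usubmx v]vsubmxK mul1mx -mulmxA.
rewrite to_cascadeE of_cascadeE; congr (col_mx (col_mx _ _) _).
  rewrite mulmxBr -addrA [X in _ + X]addrCA subrr addr0 mulmxA -mulmxDl.
  by rewrite addrC hPPb mul1mx.
by rewrite mulmxDr !mulmxA P1d_Pb mul0mx add0r hP1 mul1mx.
Qed.

(** The projection [Pb Pbd] kills [B1] and fixes [L1], while [P1d] kills [L1]. So the input acts
    only on [xi], the coupling through [L1] only on [z1], and [xi] evolves autonomously. *)
Lemma closed_loop_cascade :
  to_cascade *m closed_loop_mx A1 B1 L1 A2 L2 Gam1 Gam2 P1 P1d Pb Pbd K =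
  cascade_mx *m to_cascade.
Proof.
apply: eq_mulmx_col => v; rewrite -[v]vsubmxK -[usubmx v]vsubmxK -!mulmxA.
set x1 := usubmx (usubmx v); set x2 := dsubmx (usubmx v); set xh := dsubmx v.
rewrite closed_loop_mxE !to_cascadeE cascade_mxE.
have PbE : Pb *m Pbd = 1%:M - P1 *m P1d by rewrite -hPPb addrAC subrr add0r.
have [xi xiE] : exists xi, xi = P1d *m x1 - xh by eexists.
have [z1 z1E] : exists z1, z1 = Pb *m Pbd *m x1 + P1 *m xh by eexists.
have x1E : x1 = z1 + P1 *m xi.
  rewrite z1E xiE mulmxBr -addrA [X in _ + X]addrCA subrr addr0 mulmxA -mulmxDl.
  by rewrite addrC hPPb mul1mx.
have PbB : Pb *m Pbd *m B1 = 0 by rewrite PbE mulmxBl mul1mx hB1 subrr.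
have PbL : Pb *m Pbd *m L1 = L1.
  by rewrite PbE mulmxBl mul1mx -mulmxA hL1 mulmx0 subr0.
have PE : P1 *m (P1d *m A1 *m P1 *m xh + P1d *m A1 *m Pb *m Pbd *m x1) =
    P1 *m P1d *m (A1 *m z1).
  by rewrite z1E !mulmxDr !mulmxA addrC.
rewrite -xiE -z1E PE; congr (col_mx (col_mx _ _) _).
- rewrite mulmxDr mulmxDr [Pb *m Pbd *m (B1 *m _)]mulmxA PbB mul0mx addr0.
  rewrite -[L1 *m _ *m _]mulmxA [Pb *m Pbd *m (L1 *m _)]mulmxA PbL {1}x1E.
  (* The two projections of [A1 z1], one from the plant and one from the controller, add up to
     [A1 z1]. *)
  rewrite !mulmxDr -[X in _ = X + _ + _](mul1mx) -hPPb mulmxDl !mulmxA.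
  move: (Pb *m _ *m _ *m z1) (P1 *m _ *m _ *m z1) (_ *m xi) (_ *m x2) => a b c d.
  by apply/matrixP => i j; rewrite !mxE; ring.
- by rewrite {1}x1E.
- rewrite !mulmxDr.
  have -> : P1d *m (L1 *m Gam2 *m x2) = 0 by rewrite !mulmxA hL1 !mul0mx.
  have -> : P1d *m A1 *m P1 *m xh + P1d *m A1 *m Pb *m Pbd *m x1 = P1d *m (A1 *m z1).
    by rewrite z1E !mulmxDr !mulmxA addrC.
  rewrite addr0 {1}x1E !mulmxDr mulmxDl !mulmxA.
  move: (_ *m z1) (_ *m A1 *m P1 *m xi) (_ *m K *m xi) => a b c.
  by apply/matrixP => i j; rewrite !mxE; ring.
Qed.

Lemma cascade_stable : stable_mx A -> stable_mx F -> stable_mx cascade_mx.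
Proof. exact: stable_block_mx. Qed.

Lemma closed_loop_stable : stable_mx A -> stable_mx F ->
  stable_mx (closed_loop_mx A1 B1 L1 A2 L2 Gam1 Gam2 P1 P1d Pb Pbd K).
Proof.
move=> sA sF; apply: stable_mx_similar of_cascadeK closed_loop_cascade _.
exact: cascade_stable.
Qed.

(** As the controller starts at zero, [z1] starts at [Pb Pbd d0], the argument of the free response,
    and [xi] at [P1d d0], which the design bound covers when [d0] is in the unit ball. *)
Lemma closed_loop_solves d0 u1 x1 x2 xh :
  preexisting_system A1 B1 L1 A2 L2 Gam1 Gam2 d0 u1 x1 x2 ->
  controller A1 P1 P1d Pb Pbd K x1 u1 xh ->
  let w t := to_cascade *m col_mx (col_mx (x1 t) (x2 t)) (xh t) in
  solves w (fun t => cascade_mx *m w t) /\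
  w 0 = col_mx (col_mx (Pb *m Pbd *m d0) 0) (P1d *m d0).
Proof.
move=> [s1 s2 x10 x20] [sh u1E xh0] w; split; last first.
  by rewrite /w to_cascadeE x10 x20 xh0 mulmx0 addr0 subr0.
have col_mxE k l (u : 'cV[R]_k) (v : 'cV[R]_l) :
    col_mx u v = col_mx 1%:M 0 *m u + col_mx 0 1%:M *m v.
  by rewrite !mul_col_mx !mul1mx !mul0mx add_col_mx addr0 add0r.
have solves_col_mx k l (x f : R -> 'cV[R]_k) (y g : R -> 'cV[R]_l) :
    solves x f -> solves y g ->
    solves (fun t => col_mx (x t) (y t)) (fun t => col_mx (f t) (g t)).
  move=> xf yg; under [X in solves X _]eq_fun do rewrite col_mxE.
  under [X in solves _ X]eq_fun do rewrite col_mxE.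
  by apply: solvesD; exact: solves_mulmx.
have := solves_mulmx to_cascade (solves_col_mx _ _ _ _ _ _ (solves_col_mx _ _ _ _ _ _ s1 s2) sh).
apply: solves_eq => t t0; rewrite /w [RHS]mulmxA -closed_loop_cascade -[RHS]mulmxA.
by rewrite closed_loop_mxE u1E// ltW.
Qed.

(** The initial state is split into its [(z1, x2)] part, which evolves freely, and its [xi] part.
    For the latter, output and [xi] are related in the frequency domain by the transfer matrix under
    the H-infinity norm. *)
Lemma cascade_L2norm k (E : 'M[R]_(n1 + n2, k)) (J : 'M[R]_(k, n1))
    (eps1 : R) (d0 : 'cV[R]_n1) (w : R -> 'cV[R]_(n1 + n2 + nh)) :
  stable_mx A -> stable_mx F -> 0 < eps1 ->
  (forall xi : R -> 'cV[R]_nh, solves xi (fun t => F *m xi t) ->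
     xi 0 = P1d *m d0 -> (L2norm xi <= eps1%:E)%E) ->
  solves w (fun t => cascade_mx *m w t) ->
  w 0 = col_mx (col_mx (Pb *m Pbd *m d0) 0) (P1d *m d0) ->
  (L2norm (fun t => row_mx E^T (J *m P1) *m w t) <=
   Hinf_norm (fun s => (transfer A1 L1 A2 L2 Gam1 Gam2 Pb Pbd E s + mxC J) *m mxC P1)
     * eps1%:E + free_response_norm A1 L1 A2 L2 Gam1 Gam2 E (Pb *m Pbd *m d0))%E.
Proof.
move=> sA sF eps0 heps sw w0.
set G := (G in Hinf_norm G); have := Hinf_norm_ge0 G.
(* An infinite norm makes the bound trivial, since [eps1] is positive. *)
case GE : (Hinf_norm G) => [g| |] // g0; last first.
  by rewrite gt0_mulye ?lte_fin// addye ?leey// gt_eqF// (lt_le_trans _ (L2norm_ge0 _)) ?ltNy0.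
have sM := cascade_stable sA sF.
pose xb t := expmx (t *: cascade_mx) *m col_mx (0 : 'cV[R]_(n1 + n2)) (P1d *m d0).
have xb0 : xb 0 = col_mx 0 (P1d *m d0) by rewrite /xb scale0r expmx0 mul1mx.
have sxb : solves xb (fun t => cascade_mx *m xb t) by exact: expmx_solves.
pose z t := expmx (t *: A) *m (E1 n1 n2 *m (Pb *m Pbd *m d0)).
pose xa t := col_mx 1%:M 0 *m z t : 'cV[R]_(n1 + n2 + nh).
have sxa : solves xa (fun t => cascade_mx *m xa t).
  have := solves_mulmx (col_mx 1%:M (0 : 'M[R]_(nh, n1 + n2))) (expmx_solves A (E1 n1 n2 *m (Pb *m Pbd *m d0))).
  apply: solves_eq => t _; rewrite /xa /cascade_mx mulmxA [RHS]mulmxA.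
  by rewrite mul_block_col mul_col_mx !mulmx1 !mulmx0 !mul1mx mul0mx !addr0.
have wE : w 0 = xa 0 + xb 0.
  rewrite w0 xb0 /xa /z scale0r expmx0 mul1mx mul_col_mx mul1mx mul0mx add_col_mx.
  by rewrite addr0 add0r /E1 mul_col_mx mul1mx mul0mx.
pose D := row_mx (0 : 'M[R]_(nh, n1 + n2)) 1%:M.
have DM : D *m cascade_mx = F *m D.
  by rewrite /D /cascade_mx mul_row_block mul_mx_row !mul0mx !mul1mx !mulmx0 mulmx1 !add0r.
have := @L2norm_superposition R _ _ _ cascade_mx (row_mx E^T (J *m P1)) D g w xa xb
  sM _ sw sxa sxb wE.
move=> /(_ _ _)/le_trans; apply.
- by rewrite lee_fin in g0.
- move=> v a; rewrite xb0 -[a]vsubmxK; set a1 := usubmx a; set a2 := dsubmx a.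
  move=> sa.
  (* The top block of the resolvent equation: [xb] starts with a zero [(z1, x2)] part, so only [a2]
     drives [a1]. *)
  have e1 : ((Complex 0 v)%:M - mxC A) *m a1 = mxC perturbation_mx *m (mxC P1 *m a2).
    have MC : mxC cascade_mx = block_mx (mxC A) (mxC (perturbation_mx *m P1)) 0 (mxC F).
      by rewrite /cascade_mx /mxC map_block_mx map_mx0.
    have vC : mxC (col_mx (0 : 'cV[R]_(n1 + n2)) (P1d *m d0)) = col_mx 0 (mxC (P1d *m d0)).
      by rewrite /mxC map_col_mx map_mx0.
    move: sa; rewrite MC vC mulmxBl mul_scalar_mx scale_col_mx mul_block_col.
    rewrite opp_col_mx add_col_mx => /eq_col_mx[/eqP + _].
    rewrite subr_eq0 => /eqP sa1.
    by rewrite mulmxBl mul_scalar_mx sa1 addrAC subrr add0r mxC_mul mulmxA.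
  have a1E : a1 = invmx ((Complex 0 v)%:M - mxC A) *m (mxC perturbation_mx *m (mxC P1 *m a2)).
    rewrite -e1 mulKmx//; exact: stable_mx_unit.
  have -> : mxC D *m col_mx a1 a2 = a2.
    by rewrite /D /mxC map_row_mx mul_row_col map_mx0 mul0mx add0r -/(mxC _) mxC1 mul1mx.
  have -> : mxC (row_mx E^T (J *m P1)) *m col_mx a1 a2 = G (Complex 0 v) *m a2.
    rewrite /mxC map_row_mx mul_row_col -!/(mxC _) a1E /G /transfer -/perturbation_mx.
    by rewrite mxC_mul -[in RHS]mulmxA [in RHS]mulmxDl !mulmxA.
  exact: Hinf_norm_bound GE.
apply: leeD.
  (* The component [D xb] is the designed dynamics started at [P1d d0]. *)
  apply: lee_wpmul2l => //; apply: heps; last by rewrite xb0 /D mul_row_col mul0mx mul1mx add0r.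
  have := solves_mulmx D sxb; apply: solves_eq => t _.
  by rewrite mulmxA DM mulmxA.
rewrite /free_response_norm le_eqVlt; apply/orP; left; apply/eqP; congr L2norm.
apply/funext => t; rewrite /xa mulmxA mul_row_col mulmx1 mulmx0 addr0 /z.
by rewrite !mulmxA.
Qed.

End ClosedLoop.

(* Column spaces are expressed as row spaces of transposes. *)
Theorem theorem3p1 (R : realType) (n1 n2 nh m p1 p2 : nat)
  (A1 : 'M[R]_n1) (B1 : 'M[R]_(n1, m)) (L1 : 'M[R]_(n1, p1))
  (A2 : 'M[R]_n2) (L2 : 'M[R]_(n2, p2))
  (Gam1 : 'M[R]_(p2, n1)) (Gam2 : 'M[R]_(p1, n2))
  (hA : stable_mx (sys_mx A1 L1 A2 L2 Gam1 Gam2))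
  (hBL : (B1^T :&: L1^T)%MS = 0)
  (P1 : 'M[R]_(n1, nh)) (P1d : 'M[R]_(nh, n1))
  (hP1 : P1d *m P1 = 1%:M)
  (hB1 : (B1^T <= P1^T)%MS)
  (hL1 : (L1^T <= kermx P1d^T)%MS)
  (Pb : 'M[R]_(n1, n1 - nh)) (Pbd : 'M[R]_(n1 - nh, n1))
  (hPb : Pbd *m Pb = 1%:M)
  (hPPb : P1 *m P1d + Pb *m Pbd = 1%:M) :
  exists (alpha1 alpha2 : \bar R) (beta1 beta2 : 'cV[R]_n1 -> \bar R),
    let G1 := transfer A1 L1 A2 L2 Gam1 Gam2 Pb Pbd (E1 n1 n2) in
    let G2 := transfer A1 L1 A2 L2 Gam1 Gam2 Pb Pbd (E2 n1 n2) in
    [/\ alpha1 = Hinf_norm (fun s => (G1 s + 1%:M) *m mxC P1),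
        alpha2 = Hinf_norm (fun s => G2 s *m mxC P1),
        beta1 = free_response_norm A1 L1 A2 L2 Gam1 Gam2 (E1 n1 n2)
      & beta2 = free_response_norm A1 L1 A2 L2 Gam1 Gam2 (E2 n1 n2)] /\
    forall (eps1 : R) (K : 'M[R]_(m, nh)),
      0 < eps1 ->
      stable_mx (P1d *m A1 *m P1 + P1d *m B1 *m K) ->
      (forall xi : R -> 'cV[R]_nh,
         solves xi (fun t => (P1d *m A1 *m P1 + P1d *m B1 *m K) *m xi t) ->
         [set P1d *m d | d in unit_ball] (xi 0) ->
         (L2norm xi <= eps1%:E)%E) ->
      stable_mx (closed_loop_mx A1 B1 L1 A2 L2 Gam1 Gam2 P1 P1d Pb Pbd K) /\
      (forall d0 : 'cV[R]_n1, unit_ball d0 ->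
       forall (u1 : R -> 'cV[R]_m) (x1 : R -> 'cV[R]_n1) (x2 : R -> 'cV[R]_n2)
         (xh : R -> 'cV[R]_nh),
         preexisting_system A1 B1 L1 A2 L2 Gam1 Gam2 d0 u1 x1 x2 ->
         controller A1 P1 P1d Pb Pbd K x1 u1 xh ->
         (L2norm x1 <= alpha1 * eps1%:E + beta1 (Pb *m Pbd *m d0)%R)%E /\
         (L2norm x2 <= alpha2 * eps1%:E + beta2 (Pb *m Pbd *m d0)%R)%E).
Proof.
(* The witnesses are fixed before [eps1] and [K] are introduced, which expresses their independence
   of the gain. *)
exists (Hinf_norm (fun s => (transfer A1 L1 A2 L2 Gam1 Gam2 Pb Pbd (E1 n1 n2) s + 1%:M) *m mxC P1)).
exists (Hinf_norm (fun s => transfer A1 L1 A2 L2 Gam1 Gam2 Pb Pbd (E2 n1 n2) s *m mxC P1)).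
exists (free_response_norm A1 L1 A2 L2 Gam1 Gam2 (E1 n1 n2)).
exists (free_response_norm A1 L1 A2 L2 Gam1 Gam2 (E2 n1 n2)).
split=> [|eps1 K eps0 hF heps]; first by split.
(* [B1] factors through [P1], on whose image [P1 P1d] is the identity. *)
have PB : P1 *m P1d *m B1 = B1.
  have /submxP[Y /(congr1 trmx)] := hB1; rewrite trmxK trmx_mul trmxK => ->.
  by rewrite mulmxA -(mulmxA P1) hP1 mulmx1.
have PL : P1d *m L1 = 0.
  by move/sub_kermxP: hL1 => /(congr1 trmx); rewrite -trmx_mul trmxK trmx0.
split=> [|d0 d01 u1 x1 x2 xh hsys hctl]; first exact: closed_loop_stable.
have [sw w0] := closed_loop_solves PB PL hPPb hsys hctl.
set w := fun t => _ in sw w0.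
have hxi (xi : R -> 'cV[R]_nh) :
    solves xi (fun t => (P1d *m A1 *m P1 + P1d *m B1 *m K) *m xi t) ->
    xi 0 = P1d *m d0 -> (L2norm xi <= eps1%:E)%E.
  by move=> sxi xi0; apply: heps => //; exists d0.
(* Since [x1 = z1 + P1 xi], the choice [J = 1] recovers [x1], and [J = 0] recovers [x2]. *)
have x12E t : row_mx (E1 n1 n2)^T (1%:M *m P1) *m w t = x1 t /\
    row_mx (E2 n1 n2)^T (0 *m P1) *m w t = x2 t.
  have : of_cascade P1 P1d *m w t = col_mx (col_mx (x1 t) (x2 t)) (xh t).
    by rewrite /w mulmxA of_cascadeK// mul1mx.
  rewrite /w to_cascadeE of_cascadeE => /eq_col_mx[/eq_col_mx[e1 e2] _].
  rewrite !mul_row_col /E1 /E2 !tr_col_mx !trmx1 !trmx0 !mul_row_col.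
  by rewrite !mul0mx !mul1mx !addr0 add0r e1.
have bound k (E : 'M[R]_(n1 + n2, k)) (J : 'M[R]_(k, n1)) :=
  cascade_L2norm E J hA hF eps0 hxi sw w0.
split.
- have := bound _ (E1 n1 n2) 1%:M; rewrite mxC1.
  by under eq_fun do rewrite (x12E _).1.
- have := bound _ (E2 n1 n2) 0.
  under eq_fun do rewrite (x12E _).2.
  rewrite (_ : (fun s => (_ + mxC 0) *m _) =
    fun s => transfer A1 L1 A2 L2 Gam1 Gam2 Pb Pbd (E2 n1 n2) s *m mxC P1)//.
  by apply/funext => s; rewrite [mxC 0]map_mx0 addr0.
Qed.
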